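(* Let $k:[0,\infty)\to(0,\infty)$ satisfy conditions (C1)–(C3) below with some $\alpha\in(0,1)$ and slowly varying $L$, and let $a=-\int_0^\infty k(s)\,ds$. If $r$ is the unique continuous solution of $r'(t)=ar(t)+\int_0^tk(t-s)r(s)\,ds$, $r(0)=1$, then $$\lim_{t\to\infty}r(t)\,t^{1-\alpha}L(t)=\frac{\sin(\alpha\pi)}{\pi}.$$ In particular, for $\alpha\in(0,1/2)$, $r\in L^2([0,\infty))$ but $r\notin L^1([0,\infty))$.
   Context: Conditions: (C1) $k\in L^1([0,\infty);(0,\infty))\cap C([0,\infty);(0,\infty))$; (C2) $t\mapsto\log\lambda(t)$ is convex, where $\lambda(t):=\int_t^\infty k(s)\,ds$; (C3) $\lambda(t)=L(t)t^{-\alpha}$ with $\alpha\in(0,1)$ and $L$ slowly varying at infinity. A measurable $L:[0,\infty)\to(0,\infty)$ is slowly varying at infinity if $L(xt)/L(t)\to1$ as $t\to\infty$ for every $x>0$. *)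

(* Defs.v *)
From Stdlib Require Import Reals Lra.
Open Scope R_scope.

(* v is the Riemann integral of f over [a,b] (independent of the proof). *)
Definition is_RInt (f : R -> R) (a b v : R) : Prop :=
  exists pr : Riemann_integrable f a b, RiemannInt pr = v.

Definition tail_integral (f : R -> R) (t l : R) : Prop :=
  forall eps, eps > 0 -> exists M, forall T, T >= M ->
    exists v, is_RInt f t T v /\ Rabs (v - l) < eps.

Definition cont_nonneg (f : R -> R) : Prop :=
  forall t, 0 <= t -> forall eps, eps > 0 -> exists delta, delta > 0 /\
    forall s, 0 <= s -> Rabs (s - t) < delta -> Rabs (f s - f t) < eps.

Definition slowly_varying (L : R -> R) : Prop :=
  forall x, x > 0 -> forall eps, eps > 0 -> exists M, forall t, t >= M ->
    Rabs (L (x * t) / L t - 1) < eps.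

Definition lim_infty (f : R -> R) (l : R) : Prop :=
  forall eps, eps > 0 -> exists M, forall t, t >= M -> Rabs (f t - l) < eps.

(* Continuous f on [0,oo) is in L^1 iff int_0^oo |f| converges;
   in L^2 iff int_0^oo f^2 converges. *)
Definition in_L1_nonneg (f : R -> R) : Prop :=
  exists l, tail_integral (fun s => Rabs (f s)) 0 l.
Definition in_L2_nonneg (f : R -> R) : Prop :=
  exists l, tail_integral (fun s => (f s) ^ 2) 0 l.

(* Main.v *)
(** Let lam be the tail of k. Convolving the equation gives the renewal equation r + lam * r = 1, and
    rho = -r' is the resolvent: rho = lam - lam * rho. Log-convexity of lam forces rho >= 0, so r decreases;
    it is also positive. Put m(t) = 1 / ((1 + t) lam(t)), which varies regularly with index alpha - 1; then
    (m * lam)(t) tends to the beta integral B = B(alpha, 1 - alpha). From m * (1 - r) = (m * lam) * r one gets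
    B int_0^t r ~ int_0^t m ~ 1 / (alpha lam(t)), and as r is monotone the asymptotics can be differentiated:
    t r(t) lam(t) tends to 1 / B. Finally B = pi / sin (alpha pi): the integral expands into the alternating
    series of the cosecant, which is summed with the Dirichlet kernel. *)

From Stdlib Require Import Reals Lra Lia FunctionalExtensionality.
From Coquelicot Require Import Coquelicot.
(* Imported last, so that [is_RInt] is the predicate of [Defs] and not the one of Coquelicot. *)
Require Import Defs.
Open Scope R_scope.

(** * Continuous functions and convolution *)

(** Convolving with [m] turns both sides of the renewal equation into weighted averages:
    [(m * lam) * r] averages a function tending to [B] with weight [r], and [m * (1 - r)] averages a
    function tending to 1 with weight [m]. Such an average converges once the last window of any
    fixed length carries a negligible share of the total weight. For the weight [r] this rests on
    the divergence of its integral, which is also what excludes [r] from L^1.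

    That [r] tends to 0 comes from monotonicity: [r t * RInt lam 0 t] is at most [(lam * r) t <= 1],
    and the integral of [lam] diverges. The same inequality gives [t * r t * lam t <= 1], from which
    square integrability follows on dyadic blocks.

    Regular variation is used only through convergence uniform on [[d, 1]], obtained for [lam] from
    its monotonicity, and through doubling inequalities [t -> 2 t]; these replace Karamata's
    theorem.

    All functions are taken continuous on the whole line, so that every integral exists and the
    convolution identities carry no side conditions. *)

Definition cts (f : R -> R) : Prop := forall x, continuous f x.
Definition cts2 (F : R -> R -> R) : Prop := forall x y, continuity_2d_pt F x y.

Lemma cts_const c : cts (fun _ => c).
Proof. intro x; apply continuous_const. Qed.
Lemma cts_id : cts (fun x => x).
Proof. intro x; apply continuous_id. Qed.
Lemma cts_plus f g : cts f -> cts g -> cts (fun x => f x + g x).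
Proof. intros Hf Hg x. apply (continuous_plus f g); auto. Qed.
Lemma cts_opp f : cts f -> cts (fun x => - f x).
Proof. intros Hf x. apply (continuous_opp f); auto. Qed.
Lemma cts_minus f g : cts f -> cts g -> cts (fun x => f x - g x).
Proof. intros Hf Hg x. apply (continuous_minus f g); auto. Qed.
Lemma cts_mult f g : cts f -> cts g -> cts (fun x => f x * g x).
Proof. intros Hf Hg x. apply (continuous_mult f g); auto. Qed.
Lemma cts_comp f g : cts f -> cts g -> cts (fun x => f (g x)).
Proof. intros Hf Hg x. apply (continuous_comp g f); auto. Qed.
Lemma cts_abs : cts Rabs.
Proof. intro x. apply continuous_Rabs. Qed.
Lemma cts_inv f : cts f -> (forall x, f x <> 0) -> cts (fun x => / f x).
Proof. intros Hf H x. apply continuous_Rinv_comp; auto. Qed.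
Lemma cts_pow f n : cts f -> cts (fun x => f x ^ n).
Proof. intros Hf; induction n; simpl; [apply cts_const | apply cts_mult; auto]. Qed.
Lemma cts_derive f df : (forall x, is_derive f x (df x)) -> cts f.
Proof. intros H x. apply (ex_derive_continuous (K:=R_AbsRing) (V:=R_NormedModule)). exists (df x); auto. Qed.

Ltac cts_tac := repeat first
  [ assumption
  | match goal with
    | |- cts (fun _ => ?c) => apply (cts_const c)
    | |- cts (fun x => x) => apply cts_id
    | |- cts (fun x => @?f x + @?g x) => apply (cts_plus f g)
    | |- cts (fun x => @?f x - @?g x) => apply (cts_minus f g)
    | |- cts (fun x => @?f x * @?g x) => apply (cts_mult f g)
    | |- cts (fun x => - @?f x) => apply (cts_opp f)
    | |- cts (fun x => @?f x ^ ?n) => apply (cts_pow f n)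
    | |- cts (fun x => Rabs (@?g x)) => apply (cts_comp Rabs g cts_abs)
    | H : cts ?f |- cts (fun x => ?f (@?g x)) => apply (cts_comp f g H)
    end ].

Lemma cts_ex_RInt f a b : cts f -> ex_RInt f a b.
Proof. intro H. apply (ex_RInt_continuous (V:=R_CompleteNormedModule)); intros; apply H. Qed.

Lemma RInt_split f a b c : cts f -> RInt f a b + RInt f b c = RInt f a c.
Proof. intro H. apply (RInt_Chasles (V:=R_CompleteNormedModule) f); apply cts_ex_RInt; auto. Qed.

Lemma RInt_add f g a b : cts f -> cts g -> RInt (fun x => f x + g x) a b = RInt f a b + RInt g a b.
Proof. intros Hf Hg. apply (RInt_plus (V:=R_CompleteNormedModule) f g); apply cts_ex_RInt; auto. Qed.

Lemma RInt_sub f g a b : cts f -> cts g -> RInt (fun x => f x - g x) a b = RInt f a b - RInt g a b.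
Proof. intros Hf Hg. apply (RInt_minus (V:=R_CompleteNormedModule) f g); apply cts_ex_RInt; auto. Qed.

Lemma RInt_mul_const c f a b : cts f -> RInt (fun x => c * f x) a b = c * RInt f a b.
Proof. intros Hf. apply (RInt_scal (V:=R_CompleteNormedModule) f); apply cts_ex_RInt; auto. Qed.

Lemma RInt_cst a b c : RInt (fun _ : R => c : R) a b = (b - a) * c.
Proof. apply (RInt_const (V:=R_CompleteNormedModule)). Qed.

Lemma RInt_same (f : R -> R) a : RInt f a a = 0.
Proof. apply (RInt_point (V:=R_CompleteNormedModule)). Qed.

Lemma RInt_congr (f g : R -> R) a b : a <= b -> (forall x, a < x < b -> f x = g x) -> RInt f a b = RInt g a b.
Proof.
  intros Hab H. apply (RInt_ext (V:=R_CompleteNormedModule)).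
  rewrite Rmin_left, Rmax_right by lra. auto.
Qed.

Lemma RInt_mono f g a b : a <= b -> cts f -> cts g -> (forall x, a < x < b -> f x <= g x) ->
  RInt f a b <= RInt g a b.
Proof. intros. apply RInt_le; auto using cts_ex_RInt. Qed.

Lemma RInt_nonneg f a b : a <= b -> cts f -> (forall x, a < x < b -> 0 <= f x) -> 0 <= RInt f a b.
Proof. intros. apply RInt_ge_0; auto using cts_ex_RInt. Qed.

Lemma RInt_le_cst f a b M : a <= b -> cts f -> (forall x, a < x < b -> f x <= M) -> RInt f a b <= (b - a) * M.
Proof. intros. rewrite <- RInt_cst. apply RInt_mono; auto using cts_const. Qed.

Lemma RInt_ge_cst f a b M : a <= b -> cts f -> (forall x, a < x < b -> M <= f x) -> (b - a) * M <= RInt f a b.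
Proof. intros. rewrite <- RInt_cst. apply RInt_mono; auto using cts_const. Qed.

Lemma RInt_abs_le f a b M : a <= b -> cts f -> (forall x, a < x < b -> Rabs (f x) <= M) ->
  Rabs (RInt f a b) <= (b - a) * M.
Proof.
  intros Hab Hf H. apply Rabs_le. split.
  - replace (- ((b - a) * M)) with ((b - a) * (- M)) by ring.
    apply RInt_ge_cst; auto. intros x Hx. specialize (H x Hx). apply Rabs_le_between in H. lra.
  - apply RInt_le_cst; auto. intros x Hx. specialize (H x Hx). apply Rabs_le_between in H. lra.
Qed.

Lemma RInt_affine f u v a b : cts f -> RInt (fun y => u * f (u * y + v)) a b = RInt f (u * a + v) (u * b + v).
Proof. intros. apply (RInt_comp_lin (V:=R_CompleteNormedModule)). apply cts_ex_RInt; auto. Qed.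

Lemma RInt_antiderivative f F a b : (forall x, is_derive F x (f x)) -> cts f -> RInt f a b = F b - F a.
Proof.
  intros HF Hf. apply is_RInt_unique. apply (is_RInt_derive (V:=R_CompleteNormedModule) F f); auto.
Qed.

Lemma derive_RInt f a t : cts f -> is_derive (fun t => RInt f a t) t (f t).
Proof.
  intro Hf. apply (is_derive_RInt f (fun t => RInt f a t) a t); [|apply Hf].
  apply filter_forall. intro b. apply (RInt_correct (V:=R_CompleteNormedModule)). apply cts_ex_RInt; auto.
Qed.

Lemma cts_RInt f a : cts f -> cts (fun t => RInt f a t).
Proof. intro Hf. apply cts_derive with f. intro; apply derive_RInt; auto. Qed.

Lemma eq_of_derive f g d : (forall x, is_derive f x (d x)) -> (forall x, is_derive g x (d x)) -> cts d ->
  f 0 = g 0 -> forall t, f t = g t.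
Proof.
  intros Hf Hg Hd H0 t.
  pose proof (RInt_antiderivative d f 0 t Hf Hd). pose proof (RInt_antiderivative d g 0 t Hg Hd). lra.
Qed.

Lemma cts2_cts F x : cts2 F -> cts (F x).
Proof.
  intros HF y. apply continuity_pt_filterlim. intros eps Heps.
  destruct (HF x y (mkposreal eps Heps)) as [d Hd].
  exists d. split; [apply d|]. intros z [_ Hz]. simpl in *. unfold Rdist in *.
  apply (Hd x z); auto. rewrite Rminus_diag, Rabs_R0. apply d.
Qed.

Lemma cts2_flip F : cts2 F -> cts2 (fun x y => F y x).
Proof.
  intros HF x y eps. destruct (HF y x eps) as [d Hd]. exists d. intros u v Hu Hv. apply (Hd v u); auto.
Qed.

Lemma cts2_comp F a b : cts2 F -> cts2 a -> cts2 b -> cts2 (fun x y => F (a x y) (b x y)).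
Proof.
  intros HF Ha Hb x y eps.
  destruct (HF (a x y) (b x y) eps) as [d Hd].
  destruct (Ha x y d) as [d1 H1]. destruct (Hb x y d) as [d2 H2].
  assert (Hm : 0 < Rmin d1 d2) by (apply Rmin_pos; [apply d1 | apply d2]).
  exists (mkposreal _ Hm). simpl. intros u v Hu Hv.
  pose proof (Rmin_l d1 d2). pose proof (Rmin_r d1 d2).
  apply Hd; [apply H1 | apply H2]; lra.
Qed.

Lemma cts2_lift1 f (g : R -> R -> R) : cts f -> cts2 g -> cts2 (fun x y => f (g x y)).
Proof.
  intros Hf Hg x y. apply continuity_1d_2d_pt_comp; [|apply Hg]. apply continuity_pt_filterlim. apply Hf.
Qed.
Lemma cts2_mult f g : cts2 f -> cts2 g -> cts2 (fun x y => f x y * g x y).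
Proof. intros Hf Hg x y. apply continuity_2d_pt_mult; auto. Qed.
Lemma cts2_plus f g : cts2 f -> cts2 g -> cts2 (fun x y => f x y + g x y).
Proof. intros Hf Hg x y. apply continuity_2d_pt_plus; auto. Qed.
Lemma cts2_minus f g : cts2 f -> cts2 g -> cts2 (fun x y => f x y - g x y).
Proof. intros Hf Hg x y. apply continuity_2d_pt_minus; auto. Qed.
Lemma cts2_fst : cts2 (fun x _ => x).
Proof. intros x y. apply continuity_2d_pt_id1. Qed.
Lemma cts2_snd : cts2 (fun _ y => y).
Proof. intros x y. apply continuity_2d_pt_id2. Qed.
Lemma cts2_const c : cts2 (fun _ _ => c).
Proof. intros x y. apply continuity_2d_pt_const. Qed.

Ltac cts2_tac := repeat first
  [ assumption
  | match goal with
    | |- cts2 (fun _ _ => ?c) => apply (cts2_const c)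
    | |- cts2 (fun x _ => x) => apply cts2_fst
    | |- cts2 (fun _ y => y) => apply cts2_snd
    | |- cts2 (fun x y => @?f x y + @?g x y) => apply (cts2_plus f g)
    | |- cts2 (fun x y => @?f x y - @?g x y) => apply (cts2_minus f g)
    | |- cts2 (fun x y => @?f x y * @?g x y) => apply (cts2_mult f g)
    | H : cts ?f |- cts2 (fun x y => ?f (@?g x y)) => apply (cts2_lift1 f g H)
    | H : cts2 ?F |- cts2 (fun x y => ?F (@?a x y) (@?b x y)) => apply (cts2_comp F a b H)
    end ].

(** * Integrals depending on a parameter, and Fubini on a triangle *)

Lemma cts_RInt_param F a b : cts2 F -> a <= b -> cts (fun x => RInt (F x) a b).
Proof.
  intros HF Hab x. apply continuity_pt_filterlim. intros eps Heps.
  (* The [+ 1] covers [a = b] and makes the final estimate strict. *)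
  assert (He : 0 < eps / (b - a + 1)) by (apply Rdiv_lt_0_compat; lra).
  destruct (uniform_continuity_2d_1d' (fun u v => F u v) a b x (fun y _ => HF x y) (mkposreal _ He)) as [d Hd].
  exists d. split; [apply d|]. intros z [_ Hz]. simpl in *. unfold Rdist in *.
  rewrite <- RInt_sub by (apply cts2_cts; auto).
  apply Rle_lt_trans with ((b - a) * (eps / (b - a + 1))).
  - apply RInt_abs_le; [lra| apply cts_minus; apply cts2_cts; auto|].
    intros y Hy. left. pose proof (cond_pos d). apply Rabs_lt_between in Hz.
    apply (Hd y x y z); try lra. rewrite Rminus_diag, Rabs_R0. lra.
  - replace ((b - a) * (eps / (b - a + 1))) with (eps - eps / (b - a + 1)) by (field; lra). lra.
Qed.

(** The affine substitution [s = (b x - a x) v + a x] moves the variable bounds into the integrand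
    and leaves the fixed interval [[0, 1]]; with oriented integrals the order of [a x] and [b x] is
    irrelevant. *)
Lemma cts_RInt_param_bounds F a b : cts2 F -> cts a -> cts b ->
  cts (fun x => RInt (F x) (a x) (b x)).
Proof.
  intros HF Ha Hb.
  replace (fun x => RInt (F x) (a x) (b x))
    with (fun x => RInt (fun v => (b x - a x) * F x ((b x - a x) * v + a x)) 0 1).
  - assert (H1 : cts2 (fun x _ => a x)) by (apply (cts2_lift1 a (fun x _ => x)); auto using cts2_fst).
    assert (H2 : cts2 (fun x _ => b x)) by (apply (cts2_lift1 b (fun x _ => x)); auto using cts2_fst).
    apply (cts_RInt_param (fun x v => (b x - a x) * F x ((b x - a x) * v + a x))); [|lra]. cts2_tac.
  - apply functional_extensionality. intro x.
    rewrite (RInt_affine (F x) (b x - a x) (a x) 0 1) by (apply cts2_cts; auto).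
    f_equal; ring.
Qed.

(** Both sides vanish at [t = 0] and have the same derivative [RInt (F t) 0 t]. *)
Lemma Fubini_triangle F t : cts2 F ->
  RInt (fun s => RInt (fun u => F s u) 0 s) 0 t = RInt (fun u => RInt (fun s => F s u) u t) 0 t.
Proof.
  intro HF. revert t.
  assert (HFf : cts2 (fun u s => F s u)) by (apply cts2_flip; auto).
  assert (H1 : cts (fun s => RInt (fun u => F s u) 0 s))
    by (apply (cts_RInt_param_bounds F (fun _ => 0) (fun s => s)); cts_tac; auto).
  assert (Hd : forall y v, is_derive (fun z => RInt (fun s => F s v) v z) y (F y v)).
  { intros y v. apply (derive_RInt (fun s => F s v)). apply (cts2_cts (fun u s => F s u)); auto. }
  assert (HD : (fun u v => Derive (fun z => RInt (fun s => F s v) v z) u) = F).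
  { apply functional_extensionality; intro y. apply functional_extensionality; intro v.
    apply is_derive_unique, Hd. }
  assert (H2 : forall y, cts (fun u => RInt (fun s => F s u) u y)).
  { intro y. apply (cts_RInt_param_bounds (fun u s => F s u) (fun u => u) (fun _ => y)); cts_tac; auto. }
  apply (eq_of_derive _ _ (fun s => RInt (fun u => F s u) 0 s)); auto.
  - intro t. apply (derive_RInt (fun s => RInt (fun u => F s u) 0 s)); auto.
  - intro t.
    (* Leibniz rule with a moving upper bound. The boundary term is the inner integral at [u = t],
       taken over [[t, t]], hence zero. *)
    assert (Hx := is_derive_RInt_param_bound_comp_aux3
      (fun x u => RInt (fun s => F s u) u x) 0 (fun x => x) t 1).
    simpl in Hx. rewrite RInt_same, Rmult_0_l, Rplus_0_r in Hx.
    replace (RInt (fun u => F t u) 0 t) with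
      (RInt (fun u => Derive (fun x => RInt (fun s => F s u) u x) t) 0 t).
    2:{ f_equal. apply functional_extensionality. intro u. apply is_derive_unique, Hd. }
    apply Hx; clear Hx.
    + apply filter_forall. intro y. apply cts_ex_RInt, H2.
    + exists (mkposreal 1 Rlt_0_1). apply filter_forall. intro y. apply cts_ex_RInt, H2.
    + apply (is_derive_id (K:=R_AbsRing)).
    + exists (mkposreal 1 Rlt_0_1). apply filter_forall. intros y v _. exists (F y v). apply Hd.
    + intros v _. rewrite HD. apply HF.
    + rewrite HD. exists (mkposreal 1 Rlt_0_1). intros. apply HF.
    + apply continuity_pt_filterlim. apply H2.
  - now rewrite !RInt_same.
Qed.

(** * Convolution on the half-line *)

Definition conv (f g : R -> R) (t : R) : R := RInt (fun s => f (t - s) * g s) 0 t.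

Lemma cts_conv f g : cts f -> cts g -> cts (conv f g).
Proof.
  intros Hf Hg. apply (cts_RInt_param_bounds (fun t s => f (t - s) * g s) (fun _ => 0) (fun t => t)).
  - cts2_tac.
  - cts_tac.
  - cts_tac.
Qed.

Lemma conv_comm f g t : cts f -> cts g -> conv f g t = conv g f t.
Proof.
  intros Hf Hg. unfold conv.
  assert (H : cts (fun s => f (t - s) * g s)) by cts_tac.
  pose proof (RInt_affine _ (-1) t 0 t H) as E. cbv beta in E.
  replace (-1 * 0 + t) with t in E by ring. replace (-1 * t + t) with 0 in E by ring.
  pose proof (RInt_split (fun s => f (t - s) * g s) 0 t 0 H) as E2. rewrite RInt_same in E2.
  replace (RInt (fun s => g (t - s) * f s) 0 t)
    with (- RInt (fun y => -1 * (f (t - (-1 * y + t)) * g (-1 * y + t))) 0 t); [rewrite E; lra|].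
  rewrite RInt_mul_const.
  - match goal with |- - (-1 * ?x) = ?y => replace x with y; [lra|] end.
    f_equal. apply functional_extensionality. intro s. replace (t - (-1 * s + t)) with s by ring.
    replace (-1 * s + t) with (t - s) by ring. ring.
  - cts_tac.
Qed.

(** Exchange of the order of integration on the triangle [0 <= u <= s <= t], followed by the shift
    [s -> s + u] in the inner integral. *)
Lemma conv_assoc f g h t : cts f -> cts g -> cts h -> conv f (conv g h) t = conv (conv f g) h t.
Proof.
  intros Hf Hg Hh. unfold conv.
  transitivity (RInt (fun s => RInt (fun u => f (t - s) * (g (s - u) * h u)) 0 s) 0 t).
  { f_equal. apply functional_extensionality. intro s. rewrite RInt_mul_const by cts_tac. auto. }
  rewrite (Fubini_triangle (fun s u => f (t - s) * (g (s - u) * h u))) by cts2_tac.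
  f_equal. apply functional_extensionality. intro u.
  assert (H : cts (fun s => f (t - s) * g (s - u))) by cts_tac.
  transitivity (h u * RInt (fun s => f (t - s) * g (s - u)) u t).
  { rewrite <- RInt_mul_const by auto. f_equal. apply functional_extensionality. intro s. ring. }
  rewrite Rmult_comm. f_equal.
  pose proof (RInt_affine _ 1 u 0 (t - u) H) as E.
  replace (1 * 0 + u) with u in E by ring. replace (1 * (t - u) + u) with t in E by ring.
  rewrite <- E. f_equal. apply functional_extensionality. intro s.
  rewrite Rmult_1_l. f_equal; f_equal; ring.
Qed.

Lemma conv_sub_r f g h t : cts f -> cts g -> cts h ->
  conv f (fun s => g s - h s) t = conv f g t - conv f h t.
Proof.
  intros. unfold conv. rewrite <- RInt_sub by cts_tac. f_equal.
  apply functional_extensionality. intro s. ring.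
Qed.

Lemma conv_one f t : conv (fun _ => 1) f t = RInt f 0 t.
Proof. unfold conv. f_equal. apply functional_extensionality. intro s. ring. Qed.

Lemma conv_congr f f' g g' t : (forall s, 0 <= s -> f s = f' s) -> (forall s, 0 <= s -> g s = g' s) ->
  0 <= t -> conv f g t = conv f' g' t.
Proof. intros Hf Hg Ht. apply RInt_congr; auto. intros s Hs. rewrite Hf, Hg by lra. auto. Qed.

(** * The resolvent of a log-convex kernel *)

Lemma cts_eps f x eps : cts f -> 0 < eps -> exists d, 0 < d /\ forall y, Rabs (y - x) < d -> Rabs (f y - f x) < eps.
Proof.
  intros Hf He. pose proof (proj2 (continuity_pt_filterlim f x) (Hf x)) as H.
  destruct (H eps He) as [d [Hd H']]. exists d. split; auto. intros y Hy.
  destruct (Req_dec y x) as [->|Hne]; [rewrite Rminus_diag, Rabs_R0; lra|].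
  apply (H' y). split; [split; [exact I | auto] | exact Hy].
Qed.

(** The point [t0] is the supremum of the times up to which [f] stays positive; continuity excludes
    both signs at [t0]. *)
Lemma first_zero f t1 : cts f -> 0 < f 0 -> 0 <= t1 -> f t1 <= 0 ->
  exists t0, 0 < t0 /\ f t0 = 0 /\ forall s, 0 <= s < t0 -> 0 < f s.
Proof.
  intros Hf H0 Ht1 Hft1.
  set (E := fun t => 0 <= t /\ forall s, 0 <= s <= t -> 0 < f s).
  destruct (completeness E) as [t0 [Hub Hlub]].
  - exists t1. intros t [Ht H]. destruct (Rle_dec t t1); auto. specialize (H t1). lra.
  - exists 0. split; [lra|]. intros s Hs. replace s with 0 by lra. auto.
  - assert (Hpos : forall s, 0 <= s < t0 -> 0 < f s).
    { intros s Hs. destruct (Rlt_dec 0 (f s)) as [|Hn]; auto. exfalso.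
      assert (t0 <= s); [|lra]. apply Hlub. intros t [Ht H].
      destruct (Rle_dec t s); auto. exfalso. apply Hn, H. lra. }
    (* Points with [f s <= 0] accumulate at [t0]; otherwise positivity would extend to
       [t0 + d / 2]. *)
    assert (Hle : forall d, 0 < d -> exists s, 0 <= s /\ s < t0 + d /\ t0 - d < s /\ f s <= 0).
    { intros d Hd. destruct (Classical_Prop.classic (exists s, 0 <= s /\ s < t0 + d /\ t0 - d < s /\ f s <= 0)) as [|Hn]; auto.
      exfalso. assert (t0 + d / 2 <= t0); [|lra]. apply Hub.
      assert (Ht0 : 0 <= t0).
      { apply Hub. split; [lra|]. intros s Hs. replace s with 0 by lra. auto. }
      split; [lra|]. intros s Hs. destruct (Rlt_dec 0 (f s)); auto. exfalso. apply Hn. exists s.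
      assert (~ s < t0) by (intro; specialize (Hpos s); lra). repeat split; lra. }
    assert (Ht0 : 0 <= t0).
    { apply Hub. split; [lra|]. intros s Hs. replace s with 0 by lra. auto. }
    assert (Hz : f t0 <= 0).
    { apply Rnot_lt_le. intro Hp. destruct (cts_eps f t0 (f t0) Hf Hp) as [d [Hd H]].
      destruct (Hle d Hd) as [s Hs]. assert (Hs' : Rabs (s - t0) < d) by (apply Rabs_def1; lra).
      specialize (H s Hs'). apply Rabs_lt_between in H. lra. }
    assert (Hlt : 0 < t0). { destruct Ht0 as [|<-]; auto. lra. }
    exists t0. repeat split; auto. apply Rle_antisym; auto. apply Rnot_lt_le. intro Hn.
    destruct (cts_eps f t0 (- f t0) Hf) as [d [Hd H]]; [lra|].
    set (s := Rmax 0 (t0 - d / 2)).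
    assert (Hs : 0 <= s /\ t0 - d / 2 <= s /\ s < t0).
    { unfold s. split; [apply Rmax_l|]. split; [apply Rmax_r|]. apply Rmax_lub_lt; lra. }
    assert (Hs' : Rabs (s - t0) < d) by (apply Rabs_def1; lra).
    specialize (H s Hs'). apply Rabs_lt_between in H. specialize (Hpos s). lra.
Qed.

Lemma cts_max f a b : cts f -> a <= b -> exists m, a <= m <= b /\ forall s, a <= s <= b -> f s <= f m.
Proof.
  intros Hf Hab. destruct (continuity_ab_maj f a b Hab) as [m [H1 H2]].
  - intros c _. apply continuity_pt_filterlim, Hf.
  - exists m; auto.
Qed.

(* Continuous analogue of Kaluza's theorem: at a first zero [t0] of [rho], log-convexity gives
   [rho t * lam t0 <= lam t * RInt (fun s => lam (t0 - s) * rho s) t t0] for [t < t0],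
   which is impossible at a maximum of [rho] over a short interval ending at [t0]. *)
Lemma resolvent_nonneg lam rho :
  cts lam -> cts rho -> (forall t, 0 <= t -> 0 < lam t) ->
  (forall s t, 0 <= s <= t -> lam t <= lam s) ->
  (forall s t d, 0 <= s <= t -> 0 <= d -> lam (s + d) * lam t <= lam s * lam (t + d)) ->
  (forall t, 0 <= t -> rho t = lam t - conv lam rho t) ->
  forall t, 0 <= t -> 0 <= rho t.
Proof.
  intros Hlam Hrho Hpos Hdec Hlc Heq t1 Ht1. apply Rnot_lt_le. intro Hneg.
  destruct (first_zero rho t1) as [t0 [Ht0 [Hz Hp]]]; auto; [|lra|].
  { rewrite Heq by lra. unfold conv. rewrite RInt_same. specialize (Hpos 0). lra. }
  pose proof (Hpos 0 (Rle_refl 0)) as H0. pose proof (Hpos t0 (Rlt_le _ _ Ht0)) as Hl0.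
  assert (Hkey : forall t, 0 <= t < t0 ->
    rho t * lam t0 <= lam t * RInt (fun s => lam (t0 - s) * rho s) t t0).
  { intros t Ht.
    assert (Hc : cts (fun s => lam (t0 - s) * rho s)) by cts_tac.
    pose proof (Heq t0 (Rlt_le _ _ Ht0)) as E0. unfold conv in E0.
    rewrite <- (RInt_split _ 0 t t0 Hc) in E0.
    pose proof (Heq t (proj1 Ht)) as E1.
    (* Log-convexity in ratio form, [lam (t0 - s) * lam t <= lam (t - s) * lam t0], integrated over
       [[0, t]] against [rho], which is positive before [t0]. *)
    assert (Hle : lam t * RInt (fun s => lam (t0 - s) * rho s) 0 t <= lam t0 * conv lam rho t).
    { unfold conv. rewrite <- !RInt_mul_const by cts_tac. apply RInt_mono; [lra|cts_tac|cts_tac|].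
      intros s Hs. specialize (Hlc (t - s) t (t0 - t)).
      replace (t - s + (t0 - t)) with (t0 - s) in Hlc by ring.
      replace (t + (t0 - t)) with t0 in Hlc by ring.
      assert (Hr : 0 < rho s) by (apply Hp; lra).
      replace (lam t * (lam (t0 - s) * rho s)) with (lam (t0 - s) * lam t * rho s) by ring.
      replace (lam t0 * (lam (t - s) * rho s)) with (lam (t - s) * lam t0 * rho s) by ring.
      apply Rmult_le_compat_r; [lra|]. apply Hlc; lra. }
    set (A := RInt (fun s => lam (t0 - s) * rho s) 0 t) in *.
    set (B := RInt (fun s => lam (t0 - s) * rho s) t t0) in *.
    (* Since [rho t0 = 0], the equation at [t0] reads [A + B = lam t0]; the equation at [t] replaces
       the convolution by [lam t - rho t]. *)
    assert (A = lam t0 - B) by lra. nra. }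
  (* This [d] makes [d * (lam 0 * lam 0) <= lam t0 / 2], so that [Hkey] at the maximum point [m]
     yields [rho m * lam t0 <= rho m * (lam t0 / 2)], which contradicts [rho m > 0]. *)
  set (d := Rmin t0 (lam t0 / (2 * (lam 0 * lam 0)))).
  assert (Hq : 0 < lam t0 / (2 * (lam 0 * lam 0))).
  { apply Rdiv_lt_0_compat; auto. apply Rmult_lt_0_compat; [lra|]. apply Rmult_lt_0_compat; lra. }
  assert (Hd : 0 < d) by (apply Rmin_pos; auto).
  pose proof (Rmin_l t0 (lam t0 / (2 * (lam 0 * lam 0)))). fold d in H.
  pose proof (Rmin_r t0 (lam t0 / (2 * (lam 0 * lam 0)))). fold d in H1.
  destruct (cts_max rho (t0 - d) t0 Hrho) as [m [Hm Hmax]]; [lra|].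
  assert (Hmp : 0 < rho m).
  { apply Rlt_le_trans with (rho (t0 - d)); [apply Hp; lra | apply Hmax; lra]. }
  assert (Hmt : m < t0). { destruct Hm as [_ [|Hm]]; auto. subst m. lra. }
  assert (HI : RInt (fun s => lam (t0 - s) * rho s) m t0 <= (t0 - m) * (lam 0 * rho m)).
  { apply RInt_le_cst; [lra|cts_tac|]. intros s Hs. apply Rmult_le_compat.
    - left; apply Hpos; lra.
    - left; apply Hp; lra.
    - apply Hdec; lra.
    - apply Hmax; lra. }
  assert (Hk := Hkey m ltac:(lra)).
  assert (Hlm : lam m <= lam 0) by (apply Hdec; lra).
  assert (Hlmp : 0 < lam m) by (apply Hpos; lra).
  assert (rho m * lam t0 <= rho m * ((t0 - m) * (lam 0 * lam 0))).
  { eapply Rle_trans; [exact Hk|]. eapply Rle_trans.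
    - apply Rmult_le_compat_l; [lra|exact HI].
    - replace (rho m * ((t0 - m) * (lam 0 * lam 0))) with (lam 0 * ((t0 - m) * (lam 0 * rho m))) by ring.
      apply Rmult_le_compat_r; auto. apply Rmult_le_pos; [lra|]. apply Rmult_le_pos; lra. }
  apply Rmult_le_reg_l in H2; auto.
  assert ((t0 - m) * (lam 0 * lam 0) <= lam t0 / (2 * (lam 0 * lam 0)) * (lam 0 * lam 0)).
  { apply Rmult_le_compat_r; [|lra]. apply Rmult_le_pos; lra. }
  replace (lam t0 / (2 * (lam 0 * lam 0)) * (lam 0 * lam 0)) with (lam t0 / 2) in H3 by (field; lra).
  lra.
Qed.

(** Here [r = 1 - 1 * rho] with [*] the convolution. Convolving the resolvent equation with 1 gives
    [1 * rho = lam * 1 - lam * (1 * rho) = lam * r]. *)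
Lemma resolvent_integrated lam r rho :
  cts lam -> cts rho -> (forall t, r t = 1 - RInt rho 0 t) ->
  (forall t, 0 <= t -> rho t = lam t - conv lam rho t) ->
  forall t, 0 <= t -> r t = 1 - conv lam r t.
Proof.
  intros Hlam Hrho Hr Heq t Ht.
  assert (Hc1 : cts (fun _ => 1)) by apply cts_const.
  assert (Hcr : cts (conv (fun _ => 1) rho)) by (apply cts_conv; auto).
  assert (Er : r = fun s => 1 - conv (fun _ => 1) rho s).
  { apply functional_extensionality. intro s. rewrite conv_one. apply Hr. }
  rewrite Er. cbv beta. f_equal.
  rewrite conv_sub_r by cts_tac.
  rewrite (conv_assoc lam (fun _ => 1) rho) by auto.
  replace (conv lam (fun _ => 1)) with (conv (fun _ => 1) lam)
    by (apply functional_extensionality; intro; apply conv_comm; auto).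
  rewrite <- conv_assoc by auto.
  rewrite <- (conv_sub_r (fun _ => 1) lam (conv lam rho)) by auto using cts_conv.
  apply conv_congr; auto.
Qed.

(** * From the integro-differential equation to the renewal equation *)

Lemma cont_nonneg_cts f : cont_nonneg f -> cts (fun t => f (Rabs t)).
Proof.
  intros Hf x. apply continuity_pt_filterlim. intros eps He.
  destruct (Hf (Rabs x) (Rabs_pos x) eps He) as [d [Hd H]].
  exists d. split; auto. intros y [_ Hy]. simpl in *. unfold Rdist in *.
  apply H; [apply Rabs_pos|]. eapply Rle_lt_trans; [apply Rabs_triang_inv2|]. auto.
Qed.

Lemma is_RInt_value f g a b v : a <= b -> (forall x, a < x < b -> f x = g x) ->
  is_RInt f a b v -> v = RInt g a b.
Proof.
  intros Hab H [pr <-]. rewrite <- (RInt_Reals f a b pr). apply RInt_congr; auto.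
Qed.

Lemma is_RInt_of_cts f g a b : a <= b -> (forall x, a <= x <= b -> f x = g x) -> cts g ->
  is_RInt f a b (RInt g a b).
Proof.
  intros Hab H Hg.
  assert (Hex : ex_RInt f a b).
  { apply (ex_RInt_ext (V:=R_NormedModule) g f); [|apply cts_ex_RInt; auto].
    rewrite Rmin_left, Rmax_right by lra. intros x Hx. symmetry. apply H. lra. }
  exists (ex_RInt_Reals_0 _ _ _ Hex). rewrite <- RInt_Reals. apply RInt_congr; auto.
  intros; apply H; lra.
Qed.

(** Two tails computed up to the same large [T] differ by the integral over [[T0, t]]. With [T0 = 0]
    and [l0 = - a] this expresses [lam] through a primitive of [k]. *)
Lemma tail_integral_unique k kE t T0 l l0 : 0 <= t -> (forall x, 0 <= x -> k x = kE x) -> cts kE ->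
  tail_integral k t l -> tail_integral k T0 l0 -> 0 <= T0 <= t -> l = l0 - RInt kE T0 t.
Proof.
  intros Ht Hk HkE H1 H2 HT0.
  apply Rminus_diag_uniq. apply Rabs_eq_0. apply Rle_antisym; [|apply Rabs_pos].
  apply Rnot_lt_le. intro Hp. set (e := Rabs (l - (l0 - RInt kE T0 t))) in *.
  destruct (H1 (e / 2)) as [M1 HM1]; [lra|]. destruct (H2 (e / 2)) as [M2 HM2]; [lra|].
  set (T := Rmax t (Rmax M1 M2)).
  pose proof (Rmax_l t (Rmax M1 M2)). pose proof (Rmax_r t (Rmax M1 M2)).
  pose proof (Rmax_l M1 M2). pose proof (Rmax_r M1 M2). fold T in H, H0.
  destruct (HM1 T) as [v1 [Hv1 Hl1]]; [lra|]. destruct (HM2 T) as [v2 [Hv2 Hl2]]; [lra|].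
  apply (is_RInt_value k kE) in Hv1; [|lra|intros; apply Hk; lra].
  apply (is_RInt_value k kE) in Hv2; [|lra|intros; apply Hk; lra].
  pose proof (RInt_split kE T0 t T HkE).
  assert (E : l - (l0 - RInt kE T0 t) = (v2 - l0) - (v1 - l)) by lra.
  assert (e <= Rabs (v2 - l0) + Rabs (v1 - l)); [|lra].
  unfold e. rewrite E. unfold Rminus at 1. eapply Rle_trans; [apply Rabs_triang|].
  rewrite Rabs_Ropp. lra.
Qed.

(** Both [t] and [s + d] are convex combinations of [s] and [t + d], with complementary weights;
    adding the two convexity inequalities removes the weights. The degenerate case [s = t], [d = 0]
    is split off to allow division by [t + d - s]. *)
Lemma log_convex_ratio lam :
  (forall t, 0 <= t -> 0 < lam t) ->
  (forall x y th, 0 <= x -> 0 <= y -> 0 <= th <= 1 ->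
      ln (lam (th * x + (1 - th) * y)) <= th * ln (lam x) + (1 - th) * ln (lam y)) ->
  forall s t d, 0 <= s <= t -> 0 <= d -> lam (s + d) * lam t <= lam s * lam (t + d).
Proof.
  intros Hpos Hlc s t d Hs Hd.
  destruct (Rle_lt_dec (t + d) s) as [E|Hne].
  { assert (d = 0) by lra. assert (t = s) by lra. subst. rewrite Rplus_0_r. lra. }
  assert (HD : 0 < t + d - s) by lra.
  assert (Hth : 0 <= d / (t + d - s) <= 1).
  { split; [apply Rdiv_le_0_compat; lra|]. apply Rle_div_l; lra. }
  assert (Hth' : 0 <= (t - s) / (t + d - s) <= 1).
  { split; [apply Rdiv_le_0_compat; lra|]. apply Rle_div_l; lra. }
  pose proof (Hlc s (t + d) (d / (t + d - s)) ltac:(lra) ltac:(lra) Hth) as H1.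
  pose proof (Hlc s (t + d) ((t - s) / (t + d - s)) ltac:(lra) ltac:(lra) Hth') as H2.
  replace (d / (t + d - s) * s + (1 - d / (t + d - s)) * (t + d)) with t in H1 by (field; lra).
  replace ((t - s) / (t + d - s) * s + (1 - (t - s) / (t + d - s)) * (t + d)) with (s + d) in H2 by (field; lra).
  replace ((t - s) / (t + d - s)) with (1 - d / (t + d - s)) in H2 by (field; lra).
  assert (Hp1 : 0 < lam (s + d)) by (apply Hpos; lra). assert (Hp2 : 0 < lam t) by (apply Hpos; lra).
  assert (Hp3 : 0 < lam (t + d)) by (apply Hpos; lra). assert (Hp4 : 0 < lam s) by (apply Hpos; lra).
  rewrite <- (exp_ln (lam (s + d))), <- (exp_ln (lam t)), <- (exp_ln (lam (t + d))), <- (exp_ln (lam s)) by auto.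
  rewrite <- !exp_plus.
  assert (Hln : ln (lam (s + d)) + ln (lam t) <= ln (lam s) + ln (lam (t + d))) by lra.
  destruct Hln as [Hln|Hln]; [left; apply exp_increasing; auto | rewrite Hln; lra].
Qed.

(** The derivative is known only for [t > 0], so the mean value theorem is applied to
    [r0 + RInt rho 0], which needs only continuity at the endpoint 0. *)
Lemma eq_initial_minus_RInt r0 rho : cts r0 -> cts rho ->
  (forall t, 0 < t -> is_derive r0 t (- rho t)) ->
  forall t, 0 <= t -> r0 t = r0 0 - RInt rho 0 t.
Proof.
  intros Hr Hrho Hd t Ht.
  destruct (MVT_gen (fun s => r0 s + RInt rho 0 s) 0 t (fun s => - rho s + rho s)) as [c [_ Hc]].
  - rewrite Rmin_left, Rmax_right by lra. intros x Hx.
    apply (is_derive_plus (K:=R_AbsRing) (V:=R_NormedModule) r0 (fun s => RInt rho 0 s)); [apply Hd; lra|].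
    apply derive_RInt; auto.
  - intros x _. apply continuity_pt_filterlim.
    apply (cts_plus r0 (fun s => RInt rho 0 s)); auto. apply cts_RInt; auto.
  - rewrite RInt_same in Hc. lra.
Qed.

(* All functions are extended to the whole line, so that convolutions of continuous functions can be used. *)
Lemma renewal_equation (k lam r : R -> R) (a : R)
  (Hkpos : forall t, 0 <= t -> k t > 0)
  (Hkcont : cont_nonneg k)
  (Hkint : tail_integral k 0 (- a))
  (Hlam : forall t, 0 <= t -> tail_integral k t (lam t))
  (Hlampos : forall t, 0 < t -> 0 < lam t)
  (Hlogconv : forall x y th, 0 <= x -> 0 <= y -> 0 <= th <= 1 ->
      ln (lam (th * x + (1 - th) * y)) <= th * ln (lam x) + (1 - th) * ln (lam y))
  (Hrcont : cont_nonneg r)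
  (Hr0 : r 0 = 1)
  (Hrde : forall t, t > 0 -> exists v,
      is_RInt (fun s => k (t - s) * r s) 0 t v /\
      derivable_pt_lim r t (a * r t + v)) :
  exists lE rE : R -> R, cts lE /\ cts rE /\
    (forall t, 0 <= t -> lE t = lam t) /\ (forall t, 0 <= t -> rE t = r t) /\
    (forall t, 0 < lE t) /\ (forall s t, s <= t -> lE t <= lE s) /\
    (forall t, 0 <= t -> 0 < rE t) /\ (forall s t, 0 <= s <= t -> rE t <= rE s) /\
    (forall t, 0 <= t -> rE t = 1 - conv lE rE t).
Proof.
  set (kE := fun t => k (Rabs t)). set (r0 := fun t => r (Rabs t)).
  assert (HkE : cts kE) by (apply cont_nonneg_cts; auto).
  assert (Hr0c : cts r0) by (apply cont_nonneg_cts; auto).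
  assert (Ekk : forall t, 0 <= t -> k t = kE t) by (intros t Ht; unfold kE; rewrite Rabs_pos_eq; auto).
  assert (Err : forall t, 0 <= t -> r t = r0 t) by (intros t Ht; unfold r0; rewrite Rabs_pos_eq; auto).
  assert (HkEpos : forall t, 0 < kE t) by (intro t; apply Hkpos, Rabs_pos).
  (* Extension of [lam] by its primitive rather than by symmetry: it is differentiable and
     nonincreasing on the whole line, hence also positive for negative arguments. *)
  set (lE := fun t => - a - RInt kE 0 t).
  assert (HlEd : forall t, is_derive lE t (- kE t)).
  { intro t. unfold lE. replace (- kE t) with (0 - kE t) by ring.
    apply (is_derive_minus (K:=R_AbsRing) (V:=R_NormedModule) (fun _ => - a) (fun t => RInt kE 0 t)).
    - apply (is_derive_const (K:=R_AbsRing) (V:=R_NormedModule)).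
    - apply derive_RInt; auto. }
  assert (HlE : cts lE) by (apply (cts_derive lE (fun t => - kE t)); auto).
  assert (ElE : forall t, 0 <= t -> lE t = lam t).
  { intros t Ht. symmetry. apply (tail_integral_unique k kE t 0); auto. lra. }
  assert (HlEdec : forall s t, s <= t -> lE t <= lE s).
  { intros s t Hst. unfold lE. pose proof (RInt_split kE 0 s t HkE).
    assert (0 <= RInt kE s t); [|lra]. apply RInt_nonneg; auto. intros; left; apply HkEpos. }
  (* Positivity of [lam] is given for positive times; monotonicity carries it from [Rmax 1 t] back
     to every [t]. *)
  assert (HlEpos : forall t, 0 < lE t).
  { intro t. apply Rlt_le_trans with (lE (Rmax 1 t)); [|apply HlEdec, Rmax_r].
    pose proof (Rmax_l 1 t). rewrite ElE by lra. apply Hlampos; lra. }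
  set (rho := fun t => - (a * r0 t + conv kE r0 t)).
  assert (Hrho : cts rho).
  { unfold rho. pose proof (cts_conv kE r0 HkE Hr0c). cts_tac. }
  (* A second extension of [r]: the even one, [r0], may have a corner at 0, while [rE] is
     differentiable everywhere. *)
  set (rE := fun t => 1 - RInt rho 0 t).
  assert (ErE : forall t, 0 <= t -> rE t = r0 t).
  { assert (Hd0 : forall x, 0 < x -> is_derive r0 x (- rho x)).
    { intros x Hx. destruct (Hrde x Hx) as [v [Hv Hd]].
      apply (is_RInt_value _ (fun s => kE (x - s) * r0 s)) in Hv;
        [|lra|intros y Hy; rewrite Ekk, Err by lra; auto].
      apply is_derive_Reals in Hd.
      replace (- rho x) with (a * r x + v)
        by (unfold rho, conv; rewrite Hv, Err by lra; ring).
      apply (is_derive_ext_loc r r0); auto.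
      apply (locally_interval _ x 0 p_infty); simpl; auto. intros y Hy _. apply Err. lra. }
    intros t Ht. unfold rE. rewrite (eq_initial_minus_RInt r0 rho) by auto.
    rewrite <- (Err 0) by lra. rewrite Hr0. auto. }
  assert (HrEd : forall t, is_derive rE t (- rho t)).
  { intro t. unfold rE. replace (- rho t) with (0 - rho t) by ring.
    apply (is_derive_minus (K:=R_AbsRing) (V:=R_NormedModule) (fun _ => 1) (fun t => RInt rho 0 t)).
    - apply (is_derive_const (K:=R_AbsRing) (V:=R_NormedModule)).
    - apply derive_RInt; auto. }
  assert (HrE : cts rE) by (apply (cts_derive rE (fun t => - rho t)); auto).
  assert (HrE0 : rE 0 = 1) by (unfold rE; rewrite RInt_same; ring).
  assert (HlE0 : lE 0 = - a) by (unfold lE; rewrite RInt_same; ring).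
  assert (Erho' : forall t, 0 <= t -> rho t = - (a * rE t + conv kE rE t)).
  { intros t Ht. unfold rho. rewrite ErE by auto. do 2 f_equal.
    apply conv_congr; auto. intros; symmetry; auto. }
  assert (Hres : forall t, 0 <= t -> rho t = lE t - conv lE rho t).
  { intros t Ht. rewrite Erho' by auto.
    (* Integration by parts: integrating this derivative over [[0, t]] trades [conv kE rE] for
       [conv lE rho], and the boundary term [lE 0 * rE t = - a * rE t] cancels the local term of the
       equation. *)
    assert (Hd : forall s, is_derive (fun s => lE (t - s) * rE s) s (kE (t - s) * rE s - lE (t - s) * rho s)).
    { intro s. auto_derive; [split; [eexists; apply HlEd|split; [eexists; apply HrEd|auto]]|].
      rewrite (is_derive_unique _ _ _ (HlEd _)), (is_derive_unique _ _ _ (HrEd _)). fold (t - s). ring. }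
    pose proof (RInt_antiderivative _ _ 0 t Hd ltac:(cts_tac)) as E.
    rewrite RInt_sub in E by cts_tac. fold (conv kE rE t) (conv lE rho t) in E.
    rewrite Rminus_diag, Rminus_0_r, HrE0, HlE0 in E. lra. }
  assert (Hrhopos : forall t, 0 <= t -> 0 <= rho t).
  { apply (resolvent_nonneg lE rho); auto.
    - intros s t Hst. apply HlEdec; lra.
    - intros s t d Hst Hd. rewrite !ElE by lra. apply log_convex_ratio; auto.
      intros x Hx. rewrite <- ElE by auto. auto. }
  exists lE, rE. repeat split; auto.
  - intros t Ht. rewrite ErE, Err; auto.
  - intros t1 Ht1. apply Rnot_le_lt. intro Hneg.
    destruct (first_zero rE t1) as [t0 [Ht0 [Hz Hp]]]; auto; [lra|].
    (* At a first zero of [rE] the equation reduces to [rho t0 = - conv kE rE t0 < 0], against the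
       sign of [rho]. *)
    assert (Hc : 0 < conv kE rE t0).
    { unfold conv. apply RInt_gt_0; auto.
      - intros s Hs. apply Rmult_lt_0_compat; auto. apply Hp; lra.
      - intros s _. assert (Hc : cts (fun s => kE (t0 - s) * rE s)) by cts_tac. apply Hc. }
    pose proof (Hrhopos t0 (Rlt_le _ _ Ht0)) as Hq. rewrite Erho', Hz in Hq by lra. lra.
  - intros s t Hst. unfold rE. pose proof (RInt_split rho 0 s t Hrho).
    assert (0 <= RInt rho s t); [|lra]. apply RInt_nonneg; auto; [lra|]. intros; apply Hrhopos; lra.
  - apply (resolvent_integrated lE rE rho); auto.
Qed.

(** * Uniform regular variation *)

Definition ev (P : R -> Prop) : Prop := Rbar_locally p_infty P.

Lemma ev_and P Q : ev P -> ev Q -> ev (fun t => P t /\ Q t).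
Proof. apply (filter_and (F := Rbar_locally p_infty)). Qed.
Lemma ev_imp (P Q : R -> Prop) : (forall t, P t -> Q t) -> ev P -> ev Q.
Proof. apply (filter_imp (F := Rbar_locally p_infty)). Qed.
Lemma ev_gt M : ev (fun t => M < t).
Proof. exists M; auto. Qed.
Lemma ev_scale P c : 0 < c -> ev P -> ev (fun t => P (c * t)).
Proof.
  intros Hc [M HM]. exists (M / c). intros t Ht. apply HM.
  apply Rlt_div_l in Ht; auto. lra.
Qed.


Lemma lim_ev (f : R -> R) (l : R) : is_lim f p_infty l <-> forall eps, 0 < eps -> ev (fun t => Rabs (f t - l) <= eps).
Proof.
  split.
  - intros H eps He. apply is_lim_spec in H. destruct (H (mkposreal eps He)) as [M HM].
    exists M. intros t Ht. left. apply (HM t Ht).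
  - intros H. apply is_lim_spec. intro eps. destruct (H (eps / 2)) as [M HM]; [destruct eps; simpl; lra|].
    exists M. intros t Ht. specialize (HM t Ht). destruct eps; simpl in *; lra.
Qed.

Lemma lim_mult (f g : R -> R) (l m : R) : is_lim f p_infty l -> is_lim g p_infty m ->
  is_lim (fun t => f t * g t) p_infty (l * m).
Proof. intros Hf Hg. apply (is_lim_mult f g p_infty l m); simpl; auto. Qed.

Lemma lim_div (f g : R -> R) (l m : R) : is_lim f p_infty l -> is_lim g p_infty m -> m <> 0 ->
  is_lim (fun t => f t / g t) p_infty (l / m).
Proof.
  intros Hf Hg Hm. apply lim_mult; auto. apply (is_lim_inv g p_infty m); auto.
  intro H. injection H. auto.
Qed.

(** * Elementary bounds for powers *)

Lemma Rpower_pos x p : 0 < Rpower x p.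
Proof. apply exp_pos. Qed.
Lemma Rpower_le_1 x p : 0 < x <= 1 -> 0 <= p -> Rpower x p <= 1.
Proof.
  intros Hx Hp. replace 1 with (Rpower 1 p) by (unfold Rpower; rewrite ln_1, Rmult_0_r; apply exp_0).
  apply Rle_Rpower_l; lra.
Qed.
Lemma Rpower_decr x y p : 0 < x <= y -> p <= 0 -> Rpower y p <= Rpower x p.
Proof.
  intros Hx Hp. replace p with (- (- p)) by ring. rewrite !(Rpower_Ropp _ (- p)).
  apply Rinv_le_contravar; [apply Rpower_pos|]. apply Rle_Rpower_l; lra.
Qed.
Lemma Rpower_1_base p : Rpower 1 p = 1.
Proof. unfold Rpower. rewrite ln_1, Rmult_0_r. apply exp_0. Qed.
Lemma Rpower_ge_1 x p : 0 < x <= 1 -> p <= 0 -> 1 <= Rpower x p.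
Proof. intros Hx Hp. rewrite <- (Rpower_1_base p). apply Rpower_decr; auto. Qed.

Lemma Rpower_bounds d p : 0 < d -> exists c K, 0 < c /\ 1 <= K /\ forall x, d <= x <= 1 -> c <= Rpower x p <= K.
Proof.
  intros Hd. destruct (Rle_dec 0 p) as [Hp|Hp].
  - exists (Rpower d p), 1. split; [apply Rpower_pos|]. split; [lra|]. intros x Hx. split.
    + apply Rle_Rpower_l; lra.
    + apply Rpower_le_1; lra.
  - exists 1, (Rmax 1 (Rpower d p)). split; [lra|]. split; [apply Rmax_l|]. intros x Hx. split.
    + apply Rpower_ge_1; lra.
    + eapply Rle_trans; [|apply Rmax_r]. apply Rpower_decr; lra.
Qed.

Lemma Rpower_small q eps : 0 < q -> 0 < eps -> exists d0, 0 < d0 /\ forall d, 0 < d <= d0 -> Rpower d q <= eps.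
Proof.
  intros Hq He. exists (Rpower eps (/ q)). split; [apply Rpower_pos|]. intros d Hd.
  replace eps with (Rpower (Rpower eps (/ q)) q).
  - apply Rle_Rpower_l; lra.
  - rewrite Rpower_mult, Rinv_l by lra. apply Rpower_1; auto.
Qed.

(** Regular variation of index [p], uniform for [x] in [[d, 1]]. This is the range of both [s / t]
    and [(t - s) / t] in a convolution once its two ends are cut off. *)
Definition reg_var (g : R -> R) (p : R) : Prop :=
  forall d eps, 0 < d < 1 -> 0 < eps ->
    ev (fun t => forall x, d <= x <= 1 -> Rabs (g (t * x) / g t - Rpower x p) <= eps).

(** Uniformity comes from monotonicity, as in Pólya's theorem on distribution functions: on a
    geometric grid [d * rho ^ n] only finitely many pointwise limits are needed, and between
    neighbouring grid points both [g (t * x)] and [Rpower x p] are squeezed. *)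
Lemma monotone_rv g p : p < 0 -> (forall t, 0 < g t) -> (forall s t, s <= t -> g t <= g s) ->
  (forall x, 0 < x -> is_lim (fun t => g (x * t) / g t) p_infty (Rpower x p)) -> reg_var g p.
Proof.
  intros Hp Hg Hdec Hrv d eps Hd He.
  (* With [Rpower rho p = 1 - c], the power drops by at most [Rpower d p * c <= eps / 2] over one
     grid cell; the limits at the grid points use the other half of [eps]. *)
  set (c := Rmin (/ 2) (eps / (2 * Rpower d p))).
  assert (Hfd := Rpower_pos d p).
  assert (Hc : 0 < c <= / 2 /\ c <= eps / (2 * Rpower d p)).
  { repeat split; [apply Rmin_pos; [lra|apply Rdiv_lt_0_compat; lra] | apply Rmin_l | apply Rmin_r]. }
  set (rho := Rpower (1 - c) (/ p)).
  assert (Hrp : Rpower rho p = 1 - c).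
  { unfold rho. rewrite Rpower_mult, Rinv_l by lra. apply Rpower_1; lra. }
  assert (Hrho : 1 < rho).
  { apply Rnot_le_lt. intro H. assert (1 <= Rpower rho p); [|lra].
    apply Rpower_ge_1; [split; [apply Rpower_pos|auto]|lra]. }
  assert (Hind : forall n, ev (fun t => forall x, d <= x <= d * rho ^ n -> Rabs (g (t * x) / g t - Rpower x p) <= eps)).
  { assert (Hlim : forall x e, 0 < x -> 0 < e -> ev (fun t => Rabs (g (t * x) / g t - Rpower x p) <= e)).
    { intros x e Hx He'. pose proof (proj1 (lim_ev _ _) (Hrv x Hx) e He') as H.
      refine (ev_imp _ _ _ H). intros t Ht. rewrite Rmult_comm. auto. }
    induction n as [|n IH].
    - refine (ev_imp _ _ _ (Hlim d eps _ _)); [|lra|lra]. intros t Ht x Hx.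
      simpl in Hx. replace x with d by lra. auto.
    - assert (Hrn : 1 <= rho ^ n) by (apply pow_R1_Rle; lra).
      set (y := d * rho ^ n) in *.
      assert (Hy : d <= y) by (unfold y; nra).
      replace (d * rho ^ S n) with (y * rho) by (unfold y; simpl; ring).
      assert (Hyr : y <= y * rho) by nra.
      assert (HL1 := Hlim y (eps / 2) ltac:(lra) ltac:(lra)).
      assert (HL2 := Hlim (y * rho) (eps / 2) ltac:(lra) ltac:(lra)).
      refine (ev_imp _ _ _ (ev_and _ _ (ev_gt 0) (ev_and _ _ IH (ev_and _ _ HL1 HL2)))).
      intros t [Ht [H1 [H2 H3]]] x Hx.
      destruct (Rle_dec x y) as [Hxy|Hxy]; [apply H1; lra|].
      assert (Hgt := Hg t).
      assert (Ha : g (t * x) / g t <= g (t * y) / g t).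
      { apply Rmult_le_compat_r; [left; apply Rinv_0_lt_compat; auto|]. apply Hdec. apply Rmult_le_compat_l; lra. }
      assert (Hb : g (t * (y * rho)) / g t <= g (t * x) / g t).
      { apply Rmult_le_compat_r; [left; apply Rinv_0_lt_compat; auto|]. apply Hdec. apply Rmult_le_compat_l; lra. }
      assert (Hpx : Rpower (y * rho) p <= Rpower x p) by (apply Rpower_decr; lra).
      assert (Hpy : Rpower x p <= Rpower y p) by (apply Rpower_decr; lra).
      assert (Hgap : Rpower y p - Rpower (y * rho) p <= eps / 2).
      { rewrite <- (Rpower_mult_distr y rho p) by lra. rewrite Hrp.
        replace (Rpower y p - Rpower y p * (1 - c)) with (Rpower y p * c) by ring.
        apply Rle_trans with (Rpower d p * (eps / (2 * Rpower d p))).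
        - apply Rmult_le_compat; try lra; [left; apply Rpower_pos|]. apply Rpower_decr; lra.
        - right. field. lra. }
      apply Rabs_le_between in H2. apply Rabs_le_between in H3. apply Rabs_le. lra. }
  destruct (Pow_x_infinity rho) with (b := / d) as [n Hn]; [rewrite Rabs_pos_eq; lra|].
  specialize (Hn n (le_n n)). rewrite Rabs_pos_eq in Hn by (apply pow_le; lra).
  refine (ev_imp _ _ _ (Hind n)). intros t Ht x Hx. apply Ht. split; [lra|].
  apply Rle_trans with 1; [lra|]. replace 1 with (d * / d) by (field; lra).
  apply Rmult_le_compat_l; lra.
Qed.

Lemma rv_one : reg_var (fun _ => 1) 0.
Proof.
  intros d eps Hd He. exists 0. intros t _ x Hx. rewrite Rpower_O by lra.
  replace (1 / 1 - 1) with 0 by field. rewrite Rabs_R0. lra.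
Qed.

Lemma rv_one_plus_abs : reg_var (fun t => 1 + Rabs t) 1.
Proof.
  intros d eps Hd He. exists (/ eps). intros t Ht x Hx.
  assert (0 < / eps) by (apply Rinv_0_lt_compat; auto).
  rewrite Rpower_1 by lra. rewrite (Rabs_pos_eq t), (Rabs_pos_eq (t * x)) by nra.
  replace ((1 + t * x) / (1 + t) - x) with ((1 - x) / (1 + t)) by (field; lra).
  rewrite Rabs_pos_eq by (apply Rdiv_le_0_compat; lra).
  apply Rle_div_l; [lra|]. apply Rle_trans with 1; [lra|].
  replace 1 with (eps * / eps) at 1 by (field; lra). apply Rmult_le_compat_l; lra.
Qed.

Lemma rv_mult g h p q : (forall t, 0 < g t) -> (forall t, 0 < h t) -> reg_var g p -> reg_var h q -> reg_var (fun t => g t * h t) (p + q).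
Proof.
  intros Hg Hh Hgp Hhq d eps Hd He.
  destruct (Rpower_bounds d p) as [c1 [K1 [Hc1 [HK1 HB1]]]]; [lra|].
  destruct (Rpower_bounds d q) as [c2 [K2 [Hc2 [HK2 HB2]]]]; [lra|].
  set (e := Rmin 1 (eps / (K1 + K2 + 1))).
  assert (He1 : 0 < e <= 1 /\ e <= eps / (K1 + K2 + 1)).
  { repeat split; [apply Rmin_pos; [lra|apply Rdiv_lt_0_compat; lra] | apply Rmin_l | apply Rmin_r]. }
  refine (ev_imp _ _ _ (ev_and _ _ (Hgp d e Hd _) (Hhq d e Hd _))); [|lra|lra].
  intros t [H1 H2] x Hx. specialize (H1 x Hx). specialize (H2 x Hx).
  specialize (HB1 x Hx). specialize (HB2 x Hx). pose proof (Hg t). pose proof (Hh t).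
  rewrite Rpower_plus.
  replace (g (t * x) * h (t * x) / (g t * h t)) with (g (t * x) / g t * (h (t * x) / h t)) by (field; lra).
  set (a := g (t * x) / g t) in *. set (b := h (t * x) / h t) in *.
  set (A := Rpower x p) in *. set (B := Rpower x q) in *.
  replace (a * b - A * B) with ((a - A) * (b - B) + (a - A) * B + A * (b - B)) by ring.
  assert (Hfin : e * (K1 + K2 + 1) <= eps).
  { destruct He1 as [_ He1]. apply Rle_div_r in He1; lra. }
  eapply Rle_trans; [apply Rabs_triang|]. eapply Rle_trans; [apply Rplus_le_compat_r, Rabs_triang|].
  rewrite !Rabs_mult. rewrite (Rabs_pos_eq A), (Rabs_pos_eq B) by lra.
  pose proof (Rabs_pos (a - A)). pose proof (Rabs_pos (b - B)).
  assert (Rabs (a - A) * Rabs (b - B) <= e * 1) by (apply Rmult_le_compat; lra).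
  assert (Rabs (a - A) * B <= e * K2) by (apply Rmult_le_compat; lra).
  assert (A * Rabs (b - B) <= K1 * e) by (apply Rmult_le_compat; lra).
  lra.
Qed.

Lemma rv_inv g p : (forall t, 0 < g t) -> reg_var g p -> reg_var (fun t => / g t) (- p).
Proof.
  intros Hg Hgp d eps Hd He.
  destruct (Rpower_bounds d p) as [c [K [Hc [HK HB]]]]; [lra|].
  set (e := Rmin (c / 2) (eps * (c * c / 2))).
  assert (Hcc : 0 < c * c / 2) by nra.
  assert (He1 : 0 < e <= c / 2 /\ e <= eps * (c * c / 2)).
  { repeat split; [apply Rmin_pos; [lra|apply Rmult_lt_0_compat; lra] | apply Rmin_l | apply Rmin_r]. }
  refine (ev_imp _ _ _ (Hgp d e Hd _)); [|lra].
  intros t H x Hx. specialize (H x Hx). specialize (HB x Hx). pose proof (Hg t). pose proof (Hg (t * x)).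
  rewrite Rpower_Ropp.
  set (a := g (t * x) / g t) in *. set (A := Rpower x p) in *.
  replace (/ g (t * x) / / g t) with (/ a) by (unfold a; field; lra).
  assert (Ha : c / 2 <= a). { apply Rabs_le_between in H. lra. }
  replace (/ a - / A) with ((A - a) / (a * A)) by (field; lra).
  assert (Haa : c * c / 2 <= a * A).
  { replace (c * c / 2) with (c / 2 * c) by field. apply Rmult_le_compat; lra. }
  unfold Rdiv. rewrite Rabs_mult, Rabs_inv, (Rabs_pos_eq (a * A)) by lra.
  apply Rle_div_l; [lra|]. rewrite Rabs_minus_sym.
  apply Rle_trans with e; auto. apply Rle_trans with (eps * (c * c / 2)); [lra|]. apply Rmult_le_compat_l; lra.
Qed.

(** * Integrals of regularly varying functions, by doubling *)

(** Because [p > -1], the limit ratio [Rpower (/ 2) p] is below 2, so [t * g t] grows at least by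
    the factor [/ th > 1] whenever [t] doubles. The constant 3 is a crude bound on [[t / 2, t]]. *)
Lemma rv_half_bounds g p : (forall t, 0 < g t) -> -1 < p <= 0 -> reg_var g p ->
  exists th, 0 < th < 1 /\ ev (fun t => g (t * / 2) <= 2 * th * g t /\ forall x, / 2 <= x <= 1 -> g (t * x) <= 3 * g t).
Proof.
  intros Hg Hp Hh.
  assert (H2 : 1 <= Rpower (/ 2) p < 2).
  { split; [apply Rpower_ge_1; lra|]. replace 2 with (Rpower (/ 2) (-1)) at 2.
    - replace p with (- - p) by ring. rewrite (Rpower_Ropp _ (- p)), (Rpower_Ropp _ 1), Rpower_1 by lra.
      apply Rinv_lt_contravar.
      + apply Rmult_lt_0_compat; [lra|apply Rpower_pos].
      + rewrite <- (Rpower_1 (/ 2)) at 1 by lra. unfold Rpower. apply exp_increasing.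
        assert (ln (/ 2) < 0) by (rewrite <- ln_1; apply ln_increasing; lra). nra.
    - replace (-1) with (- (1)) by ring. rewrite Rpower_Ropp, Rpower_1; lra. }
  set (e := (2 - Rpower (/ 2) p) / 2).
  (* Here [2 * th] is the midpoint between [Rpower (/ 2) p] and 2, and [e] is half of that gap. *)
  exists (/ 2 + Rpower (/ 2) p / 4). split; [lra|].
  refine (ev_imp _ _ _ (Hh (/ 2) e _ _)); [|lra|unfold e; lra].
  intros t Ht. pose proof (Hg t). split.
  - specialize (Ht (/ 2) ltac:(lra)). apply Rabs_le_between in Ht.
    assert (Hq : g (t * / 2) / g t <= 2 * (/ 2 + Rpower (/ 2) p / 4)) by (unfold e in Ht; lra).
    apply (Rle_div_l _ _ (g t)) in Hq; lra.
  - intros x Hx. specialize (Ht x Hx). apply Rabs_le_between in Ht.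
    assert (Rpower x p <= Rpower (/ 2) p) by (apply Rpower_decr; lra).
    assert (Hq : g (t * x) / g t <= 3) by (unfold e in Ht; lra).
    apply Rle_div_l in Hq; lra.
Qed.

(** Induction over dyadic scales: the half [[0, t / 2]] contributes at most [C * th * (t * g t)] and
    the half [[t / 2, t]] at most [3 / 2 * (t * g t)], and these add up to at most [C * (t * g t)]
    as soon as [C * (1 - th) >= 3 / 2]. *)
Lemma rv_RInt_le g p : cts g -> (forall t, 0 < g t) -> -1 < p <= 0 -> reg_var g p ->
  exists C, 0 < C /\ ev (fun t => RInt g 0 t <= C * (t * g t)).
Proof.
  intros Hc Hg Hp Hh. destruct (rv_half_bounds g p Hg Hp Hh) as [th [Hth [M0 HM0]]].
  set (M := Rmax 1 (M0 + 1)).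
  assert (HM1 : 1 <= M) by apply Rmax_l. assert (HMM : M0 < M) by (pose proof (Rmax_r 1 (M0 + 1)); fold M in H; lra).
  assert (HM : forall t, M <= t -> g (t * / 2) <= 2 * th * g t /\ forall x, / 2 <= x <= 1 -> g (t * x) <= 3 * g t).
  { intros t Ht. apply HM0. lra. }
  pose proof (Hg M) as HgM.
  assert (HG0 : 0 <= RInt g 0 (2 * M)) by (apply RInt_nonneg; [lra|auto|intros; left; apply Hg]).
  (* The first entry closes the induction step. The second settles the base scale [[M, 2 M]], where
     [g M <= 3 * g t]. *)
  set (C := Rmax (2 / (1 - th)) (3 * RInt g 0 (2 * M) / (M * g M))).
  assert (HC1 : 2 / (1 - th) <= C) by apply Rmax_l.
  assert (HC2 : 3 * RInt g 0 (2 * M) / (M * g M) <= C) by apply Rmax_r.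
  assert (HCp : 0 < 2 / (1 - th)) by (apply Rdiv_lt_0_compat; lra).
  exists C. split; [lra|].
  assert (Hind : forall n t, M <= t <= M * 2 ^ S n -> RInt g 0 t <= C * (t * g t)).
  { induction n as [|n IH]; intros t Ht.
    - simpl in Ht.
      assert (H3 : g M <= 3 * g t).
      { destruct (HM t ltac:(lra)) as [_ Hb]. specialize (Hb (M / t)).
        replace (t * (M / t)) with M in Hb by (field; lra). apply Hb.
        split; [apply Rle_div_r; lra | apply Rle_div_l; lra]. }
      apply Rle_div_l in HC2; [|apply Rmult_lt_0_compat; lra].
      assert (RInt g 0 t <= RInt g 0 (2 * M)).
      { rewrite <- (RInt_split g 0 t (2 * M)) by auto.
        assert (0 <= RInt g t (2 * M)); [|lra]. apply RInt_nonneg; [lra|auto|intros; left; apply Hg]. }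
      pose proof (Hg t).
      assert (M * g M <= 3 * (t * g t)) by nra.
      assert (C * (M * g M) <= C * (3 * (t * g t))) by (apply Rmult_le_compat_l; lra). lra.
    - destruct (Rle_dec t (M * 2 ^ S n)) as [Hle|Hgt]; [apply IH; lra|].
      assert (H2n : 1 <= 2 ^ n) by (apply pow_R1_Rle; lra).
      assert (H2m : 2 * M <= t). { simpl in Hgt. nra. }
      assert (Hh2 : RInt g 0 (t / 2) <= C * (t / 2 * g (t / 2))).
      { apply IH. simpl in *. lra. }
      destruct (HM t ltac:(lra)) as [Ha Hb]. fold (t / 2) in Ha.
      rewrite <- (RInt_split g 0 (t / 2) t) by auto.
      assert (RInt g (t / 2) t <= (t - t / 2) * (3 * g t)).
      { apply RInt_le_cst; [lra|auto|]. intros s Hs. replace s with (t * (s / t)) by (field; lra).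
        apply Hb. split; [apply Rle_div_r; lra | apply Rle_div_l; lra]. }
      assert (Htt : 0 < t * g t) by (apply Rmult_lt_0_compat; [lra|apply Hg]).
      assert (C * (t / 2 * g (t / 2)) <= C * (th * (t * g t))).
      { apply Rmult_le_compat_l; [lra|].
        assert (t * g (t / 2) <= t * (2 * th * g t)) by (apply Rmult_le_compat_l; lra). lra. }
      apply Rle_div_l in HC1; [|lra].
      assert (2 * (t * g t) <= C * (1 - th) * (t * g t)) by (apply Rmult_le_compat_r; lra).
      lra. }
  exists M. intros t Ht. destruct (Pow_x_infinity 2) with (b := t / M) as [n Hn]; [rewrite Rabs_pos_eq; lra|].
  specialize (Hn n (le_n n)). rewrite Rabs_pos_eq in Hn by (apply pow_le; lra).
  apply (Hind n). split; [lra|]. apply Rge_le, Rle_div_l in Hn; [|lra]. simpl.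
  assert (0 < 2 ^ n) by (apply pow_lt; lra). nra.
Qed.

(** The previous bound at [d * t], combined with [g (d * t) <= 2 * Rpower d p * g t]. The exponent
    [p + 1] is positive, so the piece near 0 becomes negligible as [d] shrinks. *)
Lemma rv_RInt_small g p : cts g -> (forall t, 0 < g t) -> -1 < p <= 0 -> reg_var g p ->
  exists C, 0 < C /\ forall d, 0 < d < 1 -> ev (fun t => RInt g 0 (d * t) <= C * Rpower d (p + 1) * (t * g t)).
Proof.
  intros Hc Hg Hp Hh. destruct (rv_RInt_le g p Hc Hg Hp Hh) as [C [HC H]].
  exists (2 * C). split; [lra|]. intros d Hd.
  refine (ev_imp _ _ _ (ev_and _ _ (ev_gt 0) (ev_and _ _ (ev_scale _ d (proj1 Hd) H) (Hh d (Rpower d p) Hd (Rpower_pos _ _))))).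
  intros t [Ht [H1 H2]]. pose proof (Hg t).
  specialize (H2 d ltac:(lra)). apply Rabs_le_between in H2.
  assert (H3 : g (t * d) / g t <= 2 * Rpower d p) by lra. apply (Rle_div_l _ _ (g t)) in H3; [|lra].
  rewrite Rpower_plus, Rpower_1 by lra. rewrite (Rmult_comm t d) in H3.
  eapply Rle_trans; [exact H1|].
  replace (2 * C * (Rpower d p * d) * (t * g t)) with (C * (d * t * (2 * Rpower d p * g t))) by ring.
  apply Rmult_le_compat_l; [lra|]. apply Rmult_le_compat_l; [|lra]. apply Rmult_le_pos; lra.
Qed.

(** * Convolutions of regularly varying functions *)

Lemma cts_Rmax d : cts (Rmax d).
Proof.
  replace (Rmax d) with (fun u => (d + u + Rabs (u - d)) * / 2).
  - cts_tac.
  - apply functional_extensionality. intro u. unfold Rmax. destruct (Rle_dec d u).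
    + rewrite Rabs_pos_eq; lra.
    + rewrite Rabs_left; lra.
Qed.

(** Truncating the base at [d] removes the singularity at 0, so that the power is continuous on the
    whole line while unchanged on [[d, 1 - d]]. *)
Lemma cts_Rpower_trunc d p : 0 < d -> cts (fun u => Rpower (Rmax d u) p).
Proof.
  intros Hd u.
  apply (continuous_comp (fun u => Rmax d u) (fun x => Rpower x p)); [apply cts_Rmax|].
  pose proof (Rmax_l d u) as H. set (x := Rmax d u) in *.
  apply (ex_derive_continuous (K:=R_AbsRing) (V:=R_NormedModule)).
  unfold Rpower. auto_derive. lra.
Qed.

(** The Euler value [B(p1 + 1, p2 + 1)], as an improper integral cut symmetrically at both ends. *)
Definition is_beta (p1 p2 B : R) : Prop :=
  forall eps, 0 < eps -> exists d0, 0 < d0 < / 2 /\ forall d, 0 < d <= d0 ->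
    Rabs (RInt (fun u => Rpower (1 - u) p1 * Rpower u p2) d (1 - d) - B) <= eps.

(** Near [s = 0] the argument [t - s] stays above [t / 2] (hence the [/ 4] in the choice of [d0]),
    so [g1 (t - s) <= 3 * g1 t]; the remaining integral of [g2] is small by [rv_RInt_small]. *)
Lemma conv_edge g1 g2 p1 p2 eps : cts g1 -> cts g2 -> (forall t, 0 < g1 t) -> (forall t, 0 < g2 t) ->
  -1 < p1 <= 0 -> -1 < p2 <= 0 -> reg_var g1 p1 -> reg_var g2 p2 -> 0 < eps ->
  exists d0, 0 < d0 < / 2 /\ forall d, 0 < d <= d0 ->
    ev (fun t => 0 <= RInt (fun s => g1 (t - s) * g2 s) 0 (d * t) <= eps * (t * (g1 t * g2 t))).
Proof.
  intros Hc1 Hc2 Hg1 Hg2 Hp1 Hp2 Hh1 Hh2 He.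
  destruct (rv_half_bounds g1 p1 Hg1 Hp1 Hh1) as [th [_ H1]].
  destruct (rv_RInt_small g2 p2 Hc2 Hg2 Hp2 Hh2) as [C [HC H2]].
  assert (He' : 0 < eps / (3 * C)) by (apply Rdiv_lt_0_compat; lra).
  destruct (Rpower_small (p2 + 1) (eps / (3 * C))) as [d1 [Hd1 Hd]]; [lra|auto|].
  exists (Rmin d1 (/ 4)). pose proof (Rmin_l d1 (/ 4)). pose proof (Rmin_r d1 (/ 4)).
  assert (0 < Rmin d1 (/ 4)) by (apply Rmin_pos; lra).
  split; [lra|]. intros d Hdd. specialize (H2 d ltac:(lra)). specialize (Hd d ltac:(lra)).
  refine (ev_imp _ _ _ (ev_and _ _ (ev_gt 0) (ev_and _ _ H1 H2))).
  intros t [Ht [[_ Ha] Hb]].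
  assert (Hdt : 0 <= d * t) by (apply Rmult_le_pos; lra).
  split.
  - apply RInt_nonneg; [lra|cts_tac|]. intros. left. apply Rmult_lt_0_compat; auto.
  - apply Rle_trans with (RInt (fun s => 3 * g1 t * g2 s) 0 (d * t)).
    + apply RInt_mono; [lra|cts_tac|cts_tac|]. intros s Hs.
      apply Rmult_le_compat_r; [left; auto|].
      assert (Hs2 : s < t / 2) by nra.
      replace (t - s) with (t * ((t - s) / t)) by (field; lra). apply Ha.
      split; [apply Rle_div_r; lra | apply (Rle_div_l _ _ t); lra].
    + rewrite RInt_mul_const by auto.
      apply Rle_trans with (3 * g1 t * (C * (eps / (3 * C)) * (t * g2 t))).
      * pose proof (Hg1 t). pose proof (Hg2 t). apply Rmult_le_compat_l; [lra|].
        eapply Rle_trans; [exact Hb|]. apply Rmult_le_compat_r; [apply Rmult_le_pos; lra|].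
        apply Rmult_le_compat_l; lra.
      * right. field. lra.
Qed.

(** After [s = t * u] both [u] and [1 - u] lie in [[d, 1]], where the two normalised factors
    converge uniformly to powers. *)
Lemma conv_middle g1 g2 p1 p2 d eps : cts g1 -> cts g2 -> (forall t, 0 < g1 t) -> (forall t, 0 < g2 t) ->
  reg_var g1 p1 -> reg_var g2 p2 -> 0 < eps -> 0 < d < / 2 ->
  ev (fun t => Rabs (RInt (fun s => g1 (t - s) * g2 s) (d * t) ((1 - d) * t) / (t * (g1 t * g2 t))
     - RInt (fun u => Rpower (1 - u) p1 * Rpower u p2) d (1 - d)) <= eps).
Proof.
  intros Hc1 Hc2 Hg1 Hg2 Hh1 Hh2 He Hd.
  destruct (Rpower_bounds d p1) as [c1 [K1 [Hcc1 [HK1 HB1]]]]; [lra|].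
  destruct (Rpower_bounds d p2) as [c2 [K2 [Hcc2 [HK2 HB2]]]]; [lra|].
  set (e := Rmin 1 (eps / (K1 + K2 + 1))).
  assert (He1 : 0 < e <= 1 /\ e <= eps / (K1 + K2 + 1)).
  { repeat split; [apply Rmin_pos; [lra|apply Rdiv_lt_0_compat; lra] | apply Rmin_l | apply Rmin_r]. }
  refine (ev_imp _ _ _ (ev_and _ _ (ev_gt 0) (ev_and _ _ (Hh1 d e _ _) (Hh2 d e _ _)))); try lra.
  intros t [Ht [H1 H2]]. pose proof (Hg1 t). pose proof (Hg2 t).
  assert (HD : 0 < t * (g1 t * g2 t)) by (apply Rmult_lt_0_compat; [lra|apply Rmult_lt_0_compat; lra]).
  set (A := fun u => Rpower (Rmax d (1 - u)) p1). set (B := fun u => Rpower (Rmax d u) p2).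
  assert (HA : cts A).
  { pose proof (cts_Rpower_trunc d p1 (proj1 Hd)) as Hx. unfold A.
    apply (cts_comp _ (fun u => 1 - u) Hx). cts_tac. }
  assert (HB : cts B) by (apply (cts_Rpower_trunc d p2); lra).
  rewrite (RInt_congr (fun u => Rpower (1 - u) p1 * Rpower u p2) (fun u => A u * B u)); [|lra|].
  2:{ intros u Hu. unfold A, B. rewrite !Rmax_right by lra. auto. }
  assert (E : RInt (fun s => g1 (t - s) * g2 s) (d * t) ((1 - d) * t) / (t * (g1 t * g2 t))
     = RInt (fun u => g1 (t * (1 - u)) / g1 t * (g2 (t * u) / g2 t)) d (1 - d)).
  { assert (Hc : cts (fun s => g1 (t - s) * g2 s)) by cts_tac.
    pose proof (RInt_affine _ t 0 d (1 - d) Hc) as E.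
    replace (t * d + 0) with (d * t) in E by ring. replace (t * (1 - d) + 0) with ((1 - d) * t) in E by ring.
    rewrite <- E. unfold Rdiv at 1. rewrite Rmult_comm, <- RInt_mul_const.
    - f_equal. apply functional_extensionality. intro u.
      replace (t - (t * u + 0)) with (t * (1 - u)) by ring. rewrite Rplus_0_r. field. lra.
    - cts_tac. }
  rewrite E. unfold Rdiv. rewrite <- RInt_sub by cts_tac.
  apply Rle_trans with ((1 - d - d) * eps); [|nra].
  apply RInt_abs_le; [lra|cts_tac|]. intros u Hu.
  specialize (H1 (1 - u) ltac:(lra)). specialize (H2 u ltac:(lra)).
  specialize (HB1 (1 - u) ltac:(lra)). specialize (HB2 u ltac:(lra)).
  unfold A, B. rewrite !Rmax_right by lra. fold (g1 (t * (1 - u)) / g1 t). fold (g2 (t * u) / g2 t).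
  set (a := g1 (t * (1 - u)) / g1 t) in *. set (b := g2 (t * u) / g2 t) in *.
  set (x := Rpower (1 - u) p1) in *. set (y := Rpower u p2) in *.
  replace (a * b - x * y) with ((a - x) * (b - y) + (a - x) * y + x * (b - y)) by ring.
  assert (Hfin : e * (K1 + K2 + 1) <= eps).
  { destruct He1 as [_ He1]. apply Rle_div_r in He1; lra. }
  eapply Rle_trans; [apply Rabs_triang|]. eapply Rle_trans; [apply Rplus_le_compat_r, Rabs_triang|].
  rewrite !Rabs_mult. rewrite (Rabs_pos_eq x), (Rabs_pos_eq y) by lra.
  pose proof (Rabs_pos (a - x)). pose proof (Rabs_pos (b - y)).
  assert (Rabs (a - x) * Rabs (b - y) <= e * 1) by (apply Rmult_le_compat; lra).
  assert (Rabs (a - x) * y <= e * K2) by (apply Rmult_le_compat; lra).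
  assert (x * Rabs (b - y) <= K1 * e) by (apply Rmult_le_compat; lra).
  lra.
Qed.

Lemma conv_asymp g1 g2 p1 p2 B : cts g1 -> cts g2 -> (forall t, 0 < g1 t) -> (forall t, 0 < g2 t) ->
  -1 < p1 <= 0 -> -1 < p2 <= 0 -> reg_var g1 p1 -> reg_var g2 p2 -> is_beta p1 p2 B ->
  is_lim (fun t => conv g1 g2 t / (t * (g1 t * g2 t))) p_infty B.
Proof.
  intros Hc1 Hc2 Hg1 Hg2 Hp1 Hp2 Hh1 Hh2 HB. apply lim_ev. intros eps He.
  destruct (HB (eps / 4)) as [d0 [Hd0 H0]]; [lra|].
  destruct (conv_edge g1 g2 p1 p2 (eps / 4)) as [d1 [Hd1 H1]]; auto; [lra|].
  destruct (conv_edge g2 g1 p2 p1 (eps / 4)) as [d2 [Hd2 H2]]; auto; [lra|].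
  set (d := Rmin d0 (Rmin d1 d2)).
  assert (Hd : 0 < d /\ d <= d0 /\ d <= d1 /\ d <= d2).
  { pose proof (Rmin_l d0 (Rmin d1 d2)). pose proof (Rmin_r d0 (Rmin d1 d2)).
    pose proof (Rmin_l d1 d2). pose proof (Rmin_r d1 d2). fold d in H, H3.
    repeat split; try lra. apply Rmin_pos; [lra|]. apply Rmin_pos; lra. }
  specialize (H0 d ltac:(lra)). specialize (H1 d ltac:(lra)). specialize (H2 d ltac:(lra)).
  assert (H3 := conv_middle g1 g2 p1 p2 d (eps / 4) Hc1 Hc2 Hg1 Hg2 Hh1 Hh2 ltac:(lra) ltac:(lra)).
  refine (ev_imp _ _ _ (ev_and _ _ (ev_gt 0) (ev_and _ _ H1 (ev_and _ _ H2 H3)))). clear H1 H2 H3.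
  intros t [Ht [H1 [H2 H3]]].
  assert (Hc : cts (fun s => g1 (t - s) * g2 s)) by cts_tac.
  assert (HD : 0 < t * (g1 t * g2 t)) by (apply Rmult_lt_0_compat; [lra|apply Rmult_lt_0_compat; auto]).
  (* The reflection [s -> t - s] identifies the right end of the convolution with the left end of
     the swapped one, so [conv_edge] covers both. *)
  assert (E : RInt (fun s => g2 (t - s) * g1 s) 0 (d * t) = RInt (fun s => g1 (t - s) * g2 s) ((1 - d) * t) t).
  { pose proof (RInt_affine _ (-1) t 0 (d * t) Hc) as E.
    replace (-1 * 0 + t) with t in E by ring. replace (-1 * (d * t) + t) with ((1 - d) * t) in E by ring.
    pose proof (RInt_split _ ((1 - d) * t) t ((1 - d) * t) Hc) as E2. rewrite RInt_same in E2.
    rewrite RInt_mul_const in E by cts_tac.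
    assert (E3 : RInt (fun s => g2 (t - s) * g1 s) 0 (d * t) =
      RInt (fun x => g1 (t - (-1 * x + t)) * g2 (-1 * x + t)) 0 (d * t)); [|lra].
    f_equal. apply functional_extensionality. intro s.
    replace (t - (-1 * s + t)) with s by ring. replace (-1 * s + t) with (t - s) by ring. ring. }
  rewrite E in H2. replace (t * (g2 t * g1 t)) with (t * (g1 t * g2 t)) in H2 by ring.
  unfold conv. rewrite <- (RInt_split _ 0 (d * t) t Hc), <- (RInt_split _ (d * t) ((1 - d) * t) t Hc).
  set (D := t * (g1 t * g2 t)) in *.
  set (I1 := RInt (fun s => g1 (t - s) * g2 s) 0 (d * t)) in *.
  set (I2 := RInt (fun s => g1 (t - s) * g2 s) (d * t) ((1 - d) * t)) in *.
  set (I3 := RInt (fun s => g1 (t - s) * g2 s) ((1 - d) * t) t) in *.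
  set (J := RInt (fun u => Rpower (1 - u) p1 * Rpower u p2) d (1 - d)) in *.
  replace ((I1 + (I2 + I3)) / D - B) with (I1 / D + I3 / D + (I2 / D - J) + (J - B)) by (field; lra).
  assert (0 <= I1 / D <= eps / 4).
  { split; [apply Rdiv_le_0_compat; lra|]. apply (Rle_div_l _ _ D); lra. }
  assert (0 <= I3 / D <= eps / 4).
  { split; [apply Rdiv_le_0_compat; lra|]. apply (Rle_div_l _ _ D); lra. }
  apply Rabs_le_between in H0. apply Rabs_le_between in H3. apply Rabs_le. lra.
Qed.

(** * Averages and monotone density *)

Lemma cts_lim_bounded f (l : R) : cts f -> is_lim f p_infty l -> exists K, 0 < K /\ forall t, 0 <= t -> Rabs (f t) <= K.
Proof.
  intros Hf Hl. destruct (proj1 (lim_ev f l) Hl 1 Rlt_0_1) as [M HM].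
  destruct (cts_max (fun t => Rabs (f t)) 0 (Rmax 0 M)) as [m [_ Hm]]; [cts_tac|apply Rmax_l|].
  exists (Rabs (f m) + Rabs l + 1).
  pose proof (Rabs_pos (f m)). pose proof (Rabs_pos l). split; [lra|]. intros t Ht.
  destruct (Rle_dec t (Rmax 0 M)) as [Hle|Hgt].
  - specialize (Hm t ltac:(lra)). lra.
  - specialize (HM t). pose proof (Rmax_r 0 M). specialize (HM ltac:(lra)).
    replace (f t) with ((f t - l) + l) by ring. eapply Rle_trans; [apply Rabs_triang|]. lra.
Qed.

(** Away from the window [[t - A, t]] the factor [f (t - s)] is close to [l]; inside it [f] is
    bounded and the weight is a vanishing share of the total. *)
Lemma conv_average f w (l : R) : cts f -> cts w -> (forall t, 0 <= t -> 0 <= w t) -> is_lim f p_infty l ->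
  ev (fun t => 0 < RInt w 0 t) ->
  (forall A, 0 < A -> is_lim (fun t => RInt w (t - A) t / RInt w 0 t) p_infty 0) ->
  is_lim (fun t => conv f w t / RInt w 0 t) p_infty l.
Proof.
  intros Hf Hw Hwp Hl HW HA. apply lim_ev. intros eps He.
  destruct (cts_lim_bounded f l Hf Hl) as [K [HK Hb]].
  destruct (proj1 (lim_ev f l) Hl (eps / 2)) as [M HM]; [lra|].
  set (A := Rmax 1 M). assert (HA1 : 1 <= A) by apply Rmax_l. assert (HAM : M <= A) by apply Rmax_r.
  pose proof (Rabs_pos l) as Hlp.
  specialize (HA A ltac:(lra)).
  assert (HA2 := proj1 (lim_ev _ _) HA (eps / (2 * (K + Rabs l))) ltac:(apply Rdiv_lt_0_compat; lra)).
  refine (ev_imp _ _ _ (ev_and _ _ (ev_gt A) (ev_and _ _ HW HA2))). clear HA HA2 HW.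
  intros t [Ht [HW H2]]. rewrite Rminus_0_r in H2.
  set (W := RInt w 0 t) in *.
  assert (Hc : cts (fun s => (f (t - s) - l) * w s)) by cts_tac.
  assert (E : conv f w t - l * W = RInt (fun s => (f (t - s) - l) * w s) 0 t).
  { unfold conv, W. rewrite <- RInt_mul_const, <- RInt_sub by cts_tac. f_equal.
    apply functional_extensionality; intro; ring. }
  replace (conv f w t / W - l) with ((conv f w t - l * W) / W) by (field; lra).
  unfold Rdiv. rewrite Rabs_mult, Rabs_inv, (Rabs_pos_eq W) by lra. apply (Rle_div_l _ _ W); [lra|].
  rewrite E, <- (RInt_split _ 0 (t - A) t Hc).
  eapply Rle_trans; [apply Rabs_triang|].
  assert (Hw1 : 0 <= RInt w (t - A) t) by (apply RInt_nonneg; [lra|auto|intros; apply Hwp; lra]).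
  assert (HsplW := RInt_split w 0 (t - A) t Hw). fold W in HsplW.
  assert (H1 : Rabs (RInt (fun s => (f (t - s) - l) * w s) 0 (t - A)) <= eps / 2 * RInt w 0 (t - A)).
  { eapply Rle_trans; [apply abs_RInt_le; [lra|apply cts_ex_RInt; auto]|].
    rewrite <- RInt_mul_const by auto. apply RInt_mono; [lra|cts_tac|cts_tac|]. intros s Hs.
    rewrite Rabs_mult, (Rabs_pos_eq (w s)) by (apply Hwp; lra).
    apply Rmult_le_compat_r; [apply Hwp; lra|]. apply HM. lra. }
  assert (H3 : Rabs (RInt (fun s => (f (t - s) - l) * w s) (t - A) t) <= (K + Rabs l) * RInt w (t - A) t).
  { eapply Rle_trans; [apply abs_RInt_le; [lra|apply cts_ex_RInt; auto]|].
    rewrite <- RInt_mul_const by auto. apply RInt_mono; [lra|cts_tac|cts_tac|]. intros s Hs.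
    rewrite Rabs_mult, (Rabs_pos_eq (w s)) by (apply Hwp; lra).
    apply Rmult_le_compat_r; [apply Hwp; lra|]. unfold Rminus at 1. eapply Rle_trans; [apply Rabs_triang|].
    rewrite Rabs_Ropp. specialize (Hb (t - s) ltac:(lra)). lra. }
  rewrite Rabs_pos_eq in H2 by (apply Rdiv_le_0_compat; lra).
  apply (Rle_div_l _ _ W) in H2; [|lra].
  assert (H4 : (K + Rabs l) * RInt w (t - A) t <= (K + Rabs l) * (eps / (2 * (K + Rabs l)) * W)).
  { apply Rmult_le_compat_l; lra. }
  replace ((K + Rabs l) * (eps / (2 * (K + Rabs l)) * W)) with (eps / 2 * W) in H4 by (field; lra).
  assert (eps / 2 * RInt w 0 (t - A) <= eps / 2 * W) by (apply Rmult_le_compat_l; lra).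
  lra.
Qed.

Lemma rv_RInt_ge g p : cts g -> (forall t, 0 < g t) -> p <= 0 -> reg_var g p ->
  ev (fun t => t * g t / 4 <= RInt g 0 t).
Proof.
  intros Hc Hg Hp Hh.
  refine (ev_imp _ _ _ (ev_and _ _ (ev_gt 0) (Hh (/ 2) (/ 2) _ _))); [|lra|lra].
  intros t [Ht H]. rewrite <- (RInt_split g 0 (t / 2) t) by auto.
  assert (0 <= RInt g 0 (t / 2)) by (apply RInt_nonneg; [lra|auto|intros; left; apply Hg]).
  assert ((t - t / 2) * (g t / 2) <= RInt g (t / 2) t); [|lra].
  apply RInt_ge_cst; [lra|auto|]. intros s Hs. pose proof (Hg t).
  assert (Hx : / 2 <= s / t <= 1) by (split; [apply Rle_div_r | apply (Rle_div_l _ _ t)]; lra).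
  specialize (H (s / t) Hx). replace (t * (s / t)) with s in H by (field; lra).
  assert (1 <= Rpower (s / t) p) by (apply Rpower_ge_1; lra).
  apply Rabs_le_between in H. assert (H3 : / 2 <= g s / g t) by lra. apply Rle_div_r in H3; lra.
Qed.

(** The integral dominates [t * g t / 4], and [t * g t] is multiplied by at least [/ th > 1] at each
    doubling. *)
Lemma rv_RInt_infty g p : cts g -> (forall t, 0 < g t) -> -1 < p <= 0 -> reg_var g p ->
  is_lim (RInt g 0) p_infty p_infty.
Proof.
  intros Hc Hg Hp Hh. apply is_lim_spec. intros K.
  destruct (rv_half_bounds g p Hg Hp Hh) as [th [Hth H1]].
  pose proof (rv_RInt_ge g p Hc Hg (proj2 Hp) Hh) as H2.
  destruct (ev_and _ _ (ev_gt 0) (ev_and _ _ H1 H2)) as [M0 HM0].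
  set (M := Rmax 1 (M0 + 1)).
  assert (HM1 : 1 <= M) by apply Rmax_l. assert (HMM : M0 < M) by (pose proof (Rmax_r 1 (M0 + 1)); fold M in H; lra).
  assert (Hin : forall n, M * g M * (/ th) ^ n <= (M * 2 ^ n) * g (M * 2 ^ n)).
  { induction n as [|n IH]; [simpl; rewrite !Rmult_1_r; lra|].
    assert (H2n : 1 <= 2 ^ n) by (apply pow_R1_Rle; lra).
    destruct (HM0 (M * 2 ^ S n)) as [_ [[Ha _] _]]; [simpl; nra|].
    replace (M * 2 ^ S n * / 2) with (M * 2 ^ n) in Ha by (simpl; field).
    simpl. simpl in Ha.
    apply Rle_trans with (/ th * (M * 2 ^ n * g (M * 2 ^ n))).
    - replace (M * g M * (/ th * (/ th) ^ n)) with (/ th * (M * g M * (/ th) ^ n)) by ring.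
      apply Rmult_le_compat_l; auto. left; apply Rinv_0_lt_compat; lra.
    - apply Rle_trans with (/ th * (M * 2 ^ n * (2 * th * g (M * (2 * 2 ^ n))))).
      + apply Rmult_le_compat_l; [left; apply Rinv_0_lt_compat; lra|]. apply Rmult_le_compat_l; auto. nra.
      + right. field. lra. }
  assert (HgM := Hg M).
  assert (Hit : 1 < / th) by (rewrite <- Rinv_1; apply Rinv_lt_contravar; lra).
  destruct (Pow_x_infinity (/ th)) with (b := 4 * (Rabs K + 1) / (M * g M)) as [n Hn]; [rewrite Rabs_pos_eq; lra|].
  specialize (Hn n (le_n n)). rewrite Rabs_pos_eq in Hn by (apply pow_le; lra).
  apply Rge_le, Rle_div_l in Hn; [|apply Rmult_lt_0_compat; lra].
  exists (M * 2 ^ n). intros t Ht.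
  assert (H2n : 1 <= 2 ^ n) by (apply pow_R1_Rle; lra).
  destruct (HM0 (M * 2 ^ n)) as [_ [_ Hb]]; [nra|]. specialize (Hin n).
  rewrite <- (RInt_split g 0 (M * 2 ^ n) t) by auto.
  assert (0 <= RInt g (M * 2 ^ n) t) by (apply RInt_nonneg; [lra|auto|intros; left; apply Hg]).
  pose proof (Rle_abs K). lra.
Qed.

(** The window integral is at most [3 * A * g t] and the total at least [t * g t / 4], so the
    quotient is at most [12 * A / t]. *)
Lemma rv_window g p A : cts g -> (forall t, 0 < g t) -> -1 < p <= 0 -> reg_var g p -> 0 < A ->
  is_lim (fun t => RInt g (t - A) t / RInt g 0 t) p_infty 0.
Proof.
  intros Hc Hg Hp Hh HA. apply lim_ev. intros eps He.
  destruct (rv_half_bounds g p Hg Hp Hh) as [th [_ H1]].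
  pose proof (rv_RInt_ge g p Hc Hg (proj2 Hp) Hh) as H2.
  refine (ev_imp _ _ _ (ev_and _ _ (ev_gt (2 * A)) (ev_and _ _ (ev_gt (12 * A / eps)) (ev_and _ _ H1 H2)))).
  intros t [Ht [Ht2 [[_ Ha] Hb]]]. pose proof (Hg t).
  assert (Htg : 0 < t * g t) by (apply Rmult_lt_0_compat; lra).
  assert (H3 : 0 <= RInt g (t - A) t) by (apply RInt_nonneg; [lra|auto|intros; left; apply Hg]).
  assert (H4 : RInt g (t - A) t <= (t - (t - A)) * (3 * g t)).
  { apply RInt_le_cst; [lra|auto|]. intros s Hs. replace s with (t * (s / t)) by (field; lra).
    apply Ha. split; [apply Rle_div_r | apply (Rle_div_l _ _ t)]; lra. }
  rewrite Rminus_0_r, Rabs_pos_eq by (apply Rdiv_le_0_compat; lra).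
  apply (Rle_div_l _ _ (RInt g 0 t)); [lra|].
  apply Rlt_div_l in Ht2; [|lra].
  assert (12 * A * g t <= t * eps * g t) by (apply Rmult_le_compat_r; lra).
  assert (eps * (t * g t / 4) <= eps * RInt g 0 t) by (apply Rmult_le_compat_l; lra).
  lra.
Qed.

Lemma Rpower_slope_at_1 al eps : 0 < eps -> exists d, 0 < d < 1 /\ forall h, h <> 0 -> Rabs h < d ->
  Rabs ((Rpower (1 + h) al - 1) / h - al) < eps.
Proof.
  intros He. destruct (derivable_pt_lim_power 1 al Rlt_0_1 eps He) as [d Hd].
  exists (Rmin d (/ 2)). pose proof (cond_pos d). pose proof (Rmin_l d (/ 2)). pose proof (Rmin_r d (/ 2)).
  split; [split; [apply Rmin_pos; lra|lra]|]. intros h Hh Hhd.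
  specialize (Hd h Hh ltac:(lra)). rewrite !Rpower_1_base, Rmult_1_r in Hd. exact Hd.
Qed.

(** As [r] decreases, [t * r t] lies between the difference quotients of its integral over
    [[t, (1 + h) t]] and [[(1 - h) t, t]]. Multiplied by [lam t] these tend to [kap] times the
    slopes of [x ^ al] from 1 to [1 + h] and [1 - h], which approach [kap * al] as [h] shrinks. *)
Lemma monotone_density r lam al (kap : R) : cts r -> (forall s t, 0 <= s <= t -> r t <= r s) ->
  (forall t, 0 < lam t) -> 0 <= kap ->
  (forall x, 0 < x -> is_lim (fun t => lam (x * t) / lam t) p_infty (Rpower x (- al))) ->
  is_lim (fun t => RInt r 0 t * lam t) p_infty kap ->
  is_lim (fun t => t * r t * lam t) p_infty (kap * al).
Proof.
  intros Hr Hdec Hlam Hk Hrv HV.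
  (* Dividing [RInt r 0 (x * t) * lam (x * t)] by [lam (x * t) / lam t] gives
     [RInt r 0 (x * t) * lam t], which tends to [kap * Rpower x al]. *)
  assert (HQ : forall x, 0 < x -> x <> 1 -> is_lim (fun t => (RInt r 0 (x * t) - RInt r 0 t) * lam t / (x - 1)) p_infty
     (kap * ((Rpower x al - 1) / (x - 1)))).
  { intros x Hx Hx1.
    apply (is_lim_ext (fun t => (RInt r 0 (x * t) * lam (x * t) / (lam (x * t) / lam t) - RInt r 0 t * lam t) * / (x - 1))).
    { intro t. pose proof (Hlam t). pose proof (Hlam (x * t)). field. repeat split; lra. }
    replace (kap * ((Rpower x al - 1) / (x - 1))) with ((kap / Rpower x (- al) - kap) * / (x - 1)).
    2:{ rewrite Rpower_Ropp. pose proof (Rpower_pos x al). field. lra. }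
    apply lim_mult; [|apply is_lim_const]. apply is_lim_minus'; [|exact HV].
    apply lim_div.
    - apply lim_ev. intros eps He. apply (ev_scale (fun t => Rabs (RInt r 0 t * lam t - kap) <= eps)); auto.
      apply (proj1 (lim_ev _ _) HV); auto.
    - apply Hrv; auto.
    - pose proof (Rpower_pos x (- al)). lra. }
  apply lim_ev. intros eps He.
  assert (He' : 0 < eps / (2 * (kap + 1))) by (apply Rdiv_lt_0_compat; lra).
  destruct (Rpower_slope_at_1 al _ He') as [d [Hd Hs]].
  assert (Hslope : forall h, h <> 0 -> Rabs h < d -> Rabs (kap * ((Rpower (1 + h) al - 1) / (1 + h - 1)) - kap * al) <= eps / 2).
  { intros h Hh Hhd. replace (1 + h - 1) with h by ring.
    rewrite <- Rmult_minus_distr_l, Rabs_mult, (Rabs_pos_eq kap) by auto.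
    specialize (Hs h Hh Hhd). apply Rle_trans with (kap * (eps / (2 * (kap + 1)))).
    - apply Rmult_le_compat_l; lra.
    - replace (kap * (eps / (2 * (kap + 1)))) with (eps / 2 - eps / (2 * (kap + 1))) by (field; lra). lra. }
  assert (H1 := Hslope (d / 2) ltac:(lra) ltac:(rewrite Rabs_pos_eq; lra)).
  assert (H2 := Hslope (- (d / 2)) ltac:(lra) ltac:(rewrite Rabs_Ropp, Rabs_pos_eq; lra)).
  assert (HQ1 := proj1 (lim_ev _ _) (HQ (1 + d / 2) ltac:(lra) ltac:(lra)) (eps / 2) ltac:(lra)).
  assert (HQ2 := proj1 (lim_ev _ _) (HQ (1 + - (d / 2)) ltac:(lra) ltac:(lra)) (eps / 2) ltac:(lra)).
  refine (ev_imp _ _ _ (ev_and _ _ (ev_gt 0) (ev_and _ _ HQ1 HQ2))). clear HQ1 HQ2 HQ Hslope Hs.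
  intros t [Ht [HQ1 HQ2]]. pose proof (Hlam t).
  assert (Ha : (RInt r 0 ((1 + d / 2) * t) - RInt r 0 t) * lam t / (1 + d / 2 - 1) <= t * r t * lam t).
  { replace (1 + d / 2 - 1) with (d / 2) by ring. apply (Rle_div_l _ _ (d / 2)); [lra|].
    replace (t * r t * lam t * (d / 2)) with (((1 + d / 2) * t - t) * r t * lam t) by ring.
    apply Rmult_le_compat_r; [lra|]. rewrite <- (RInt_split r 0 t ((1 + d / 2) * t)) by auto.
    assert (RInt r t ((1 + d / 2) * t) <= ((1 + d / 2) * t - t) * r t); [|lra].
    apply RInt_le_cst; [nra|auto|]. intros s Hs. apply Hdec; lra. }
  assert (Hb : t * r t * lam t <= (RInt r 0 ((1 + - (d / 2)) * t) - RInt r 0 t) * lam t / (1 + - (d / 2) - 1)).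
  { replace ((RInt r 0 ((1 + - (d / 2)) * t) - RInt r 0 t) * lam t / (1 + - (d / 2) - 1))
      with ((RInt r 0 t - RInt r 0 ((1 + - (d / 2)) * t)) * lam t / (d / 2)) by (field; lra).
    apply (Rle_div_r _ _ (d / 2)); [lra|].
    replace (t * r t * lam t * (d / 2)) with ((t - (1 + - (d / 2)) * t) * r t * lam t) by ring.
    apply Rmult_le_compat_r; [lra|]. rewrite <- (RInt_split r 0 ((1 + - (d / 2)) * t) t) by auto.
    assert ((t - (1 + - (d / 2)) * t) * r t <= RInt r ((1 + - (d / 2)) * t) t); [|lra].
    assert (0 <= (1 + - (d / 2)) * t) by (apply Rmult_le_pos; lra).
    apply RInt_ge_cst; [nra|auto|]. intros s Hs. apply Hdec; lra. }
  apply Rabs_le_between in HQ1. apply Rabs_le_between in HQ2. apply Rabs_le_between in H1. apply Rabs_le_between in H2.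
  apply Rabs_le. lra.
Qed.

(** * Asymptotics of the solution *)

Lemma is_derive_Rpower x p : 0 < x -> is_derive (fun u => Rpower u p) x (p * Rpower x (p - 1)).
Proof. intro Hx. apply is_derive_Reals, derivable_pt_lim_power; auto. Qed.

Lemma continuous_Rpower x p : 0 < x -> continuous (fun u => Rpower u p) x.
Proof.
  intro Hx. apply (ex_derive_continuous (K:=R_AbsRing) (V:=R_NormedModule)).
  eexists. apply is_derive_Rpower; auto.
Qed.

Lemma RInt_Rpower a b p : 0 < a <= b -> 0 < p ->
  RInt (fun u => Rpower u (p - 1)) a b = (Rpower b p - Rpower a p) / p.
Proof.
  intros Hab Hp. apply is_RInt_unique.
  replace ((Rpower b p - Rpower a p) / p) with (minus (/ p * Rpower b p) (/ p * Rpower a p))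
    by (unfold minus, plus, opp; simpl; field; lra).
  apply (is_RInt_derive (V:=R_CompleteNormedModule) (fun u => / p * Rpower u p)); rewrite Rmin_left, Rmax_right by lra; intros x Hx.
  - replace (Rpower x (p - 1)) with (/ p * (p * Rpower x (p - 1))) by (field; lra).
    apply (is_derive_scal (fun u => Rpower u p)). apply is_derive_Rpower; lra.
  - apply continuous_Rpower; lra.
Qed.

(** The value [B(1, al)], needed because the integral of [m] is treated as the convolution of [m]
    with the constant 1, of index 0. *)
Lemma is_beta_0 al : 0 < al -> is_beta 0 (al - 1) (/ al).
Proof.
  intros Hal eps He.
  destruct (Rpower_small al (eps * al / 2)) as [d1 [Hd1 H1]]; auto; [apply Rdiv_lt_0_compat; [apply Rmult_lt_0_compat|]; lra|].
  destruct (derivable_continuous_pt (fun x => Rpower x al) 1 (exist _ _ (derivable_pt_lim_power 1 al Rlt_0_1)) (eps * al / 2))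
    as [d2 [Hd2 H2]]; [apply Rdiv_lt_0_compat; [apply Rmult_lt_0_compat|]; lra|].
  set (d0 := Rmin d1 (Rmin (d2 / 2) (/ 4))).
  assert (Hd0 : 0 < d0 /\ d0 <= d1 /\ d0 <= d2 / 2 /\ d0 <= / 4).
  { pose proof (Rmin_l d1 (Rmin (d2 / 2) (/ 4))). pose proof (Rmin_r d1 (Rmin (d2 / 2) (/ 4))).
    pose proof (Rmin_l (d2 / 2) (/ 4)). pose proof (Rmin_r (d2 / 2) (/ 4)). fold d0 in H, H0.
    repeat split; try lra. apply Rmin_pos; [lra|]. apply Rmin_pos; lra. }
  exists d0. split; [lra|]. intros d Hd. specialize (H1 d ltac:(lra)).
  rewrite (RInt_congr _ (fun u => Rpower u (al - 1))) by
    (lra || (intros u Hu; rewrite Rpower_O by lra; ring)).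
  rewrite RInt_Rpower by lra.
  assert (H3 : Rabs (Rpower (1 - d) al - Rpower 1 al) < eps * al / 2).
  { apply (H2 (1 - d)). split; [split; [exact I|lra]|]. simpl. unfold Rdist.
    replace (1 - d - 1) with (- d) by ring. rewrite Rabs_Ropp, Rabs_pos_eq; lra. }
  rewrite Rpower_1_base in H3.
  replace ((Rpower (1 - d) al - Rpower d al) / al - / al) with ((Rpower (1 - d) al - 1 - Rpower d al) / al) by (field; lra).
  unfold Rdiv. rewrite Rabs_mult, Rabs_inv, (Rabs_pos_eq al) by lra. apply (Rle_div_l _ _ al); [lra|].
  pose proof (Rpower_pos d al). apply Rabs_lt_between in H3. apply Rabs_le. lra.
Qed.

(* The auxiliary kernel [m] has regular variation of index [al - 1], complementary to that of [lam], so that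
   [conv m lam] tends to the constant [B]; convolving the renewal equation with [m] then compares
   [B * RInt r 0 t] with [RInt m 0 t]. *)
Lemma renewal_asymptotics lam r al (B : R) :
  cts lam -> cts r -> (forall t, 0 < lam t) -> (forall s t, s <= t -> lam t <= lam s) ->
  (forall t, 0 <= t -> 0 < r t) -> (forall s t, 0 <= s <= t -> r t <= r s) ->
  (forall t, 0 <= t -> r t = 1 - conv lam r t) ->
  0 < al < 1 -> reg_var lam (- al) ->
  (forall x, 0 < x -> is_lim (fun t => lam (x * t) / lam t) p_infty (Rpower x (- al))) ->
  is_beta (al - 1) (- al) B -> 0 < B ->
  is_lim (fun t => t * r t * lam t) p_infty (/ B) /\
  is_lim (RInt r 0) p_infty p_infty /\
  forall t, 0 <= t -> r t * (t * lam t) <= 1.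
Proof.
  intros Hlc Hrc Hlp Hld Hrp Hrd Heq Hal Hhl Hrv HB HBp.
  (* By monotonicity [r t] can be pulled out of the convolution: [r t * RInt lam 0 t <= conv r lam t
     = 1 - r t]. *)
  assert (Hrl : forall t, 0 <= t -> r t * RInt lam 0 t <= 1).
  { intros t Ht. rewrite <- RInt_mul_const by auto.
    apply Rle_trans with (conv r lam t).
    - unfold conv. apply RInt_mono; [lra|cts_tac|cts_tac|]. intros s Hs.
      apply Rmult_le_compat_r; [left; auto|]. apply Hrd; lra.
    - rewrite conv_comm by auto. pose proof (Heq t Ht). pose proof (Hrp t Ht). lra. }
  assert (Hr0 : is_lim r p_infty 0).
  { pose proof (rv_RInt_infty lam (- al) Hlc Hlp ltac:(lra) Hhl) as HL.
    apply (is_lim_le_le_loc (fun _ => 0) (fun t => / RInt lam 0 t)).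
    - apply is_lim_spec in HL. destruct (HL 0) as [M HM]. exists (Rmax 0 M). intros t Ht.
      pose proof (Rmax_l 0 M). pose proof (Rmax_r 0 M). specialize (HM t ltac:(lra)).
      split; [left; apply Hrp; lra|]. specialize (Hrl t ltac:(lra)).
      apply Rmult_le_reg_r with (RInt lam 0 t); auto. rewrite Rinv_l by lra. auto.
    - apply is_lim_const.
    - apply (is_lim_inv _ _ p_infty); auto. discriminate. }
  (* The weight [1 + Rabs t] instead of [t] keeps [m] positive and continuous on the whole line
     without changing its behaviour at infinity. *)
  set (w := fun t => (1 + Rabs t) * lam t).
  assert (Hone : forall t, 0 < 1 + Rabs t) by (intro t; pose proof (Rabs_pos t); lra).
  assert (Hw : forall t, 0 < w t) by (intro t; apply Rmult_lt_0_compat; auto).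
  set (m := fun t => / w t).
  assert (Hmc : cts m).
  { apply cts_inv; [unfold w; cts_tac|]. intro x. pose proof (Hw x). lra. }
  assert (Hmp : forall t, 0 < m t) by (intro t; apply Rinv_0_lt_compat; auto).
  assert (Hhm : reg_var m (al - 1)).
  { replace (al - 1) with (- (1 + - al)) by ring. apply rv_inv; auto.
    apply rv_mult; auto using rv_one_plus_abs. }
  assert (Ht1 : is_lim (fun t => t * (m t * lam t)) p_infty 1).
  { apply lim_ev. intros eps He. exists (Rmax 0 (/ eps)). intros t Ht.
    pose proof (Rmax_l 0 (/ eps)). pose proof (Rmax_r 0 (/ eps)).
    unfold m, w. rewrite (Rabs_pos_eq t) by lra. pose proof (Hlp t).
    replace (t * (/ ((1 + t) * lam t) * lam t) - 1) with (- (/ (1 + t))) by (field; lra).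
    rewrite Rabs_Ropp, Rabs_pos_eq by (left; apply Rinv_0_lt_compat; lra).
    rewrite <- (Rinv_inv eps). apply Rinv_le_contravar; [apply Rinv_0_lt_compat; auto|lra]. }
  assert (Hml : is_lim (conv m lam) p_infty B).
  { apply (is_lim_ext_loc (fun t => conv m lam t / (t * (m t * lam t)) * (t * (m t * lam t)))).
    - exists 0. intros t Ht. field. pose proof (Hmp t). pose proof (Hlp t). lra.
    - replace B with (B * 1) by ring. apply lim_mult; auto.
      apply (conv_asymp m lam (al - 1) (- al)); auto; lra. }
  assert (HMinf : is_lim (RInt m 0) p_infty p_infty) by (apply (rv_RInt_infty m (al - 1)); auto; lra).
  assert (HMpos : ev (fun t => 0 < RInt m 0 t)).
  { apply is_lim_spec in HMinf. apply (HMinf 0). }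
  assert (HMl : is_lim (fun t => RInt m 0 t * lam t) p_infty (/ al)).
  { apply (is_lim_ext_loc (fun t => conv (fun _ => 1) m t / (t * (1 * m t)) * (t * (m t * lam t)))).
    - exists 0. intros t Ht. rewrite conv_one. field. pose proof (Hmp t). pose proof (Hlp t). lra.
    - replace (/ al) with (/ al * 1) by ring. apply lim_mult; auto.
      apply (conv_asymp (fun _ => 1) m 0 (al - 1)); auto using cts_const, rv_one; try lra.
      + intros _. lra.
      + apply is_beta_0; lra. }
  set (q := fun t => conv (conv m lam) r t).
  assert (Hcml : cts (conv m lam)) by (apply cts_conv; auto).
  assert (Hq : forall t, 0 <= t -> q t = conv (fun s => 1 - r s) m t).
  { intros t Ht. unfold q. rewrite <- conv_assoc by auto. rewrite (conv_comm (fun s => 1 - r s)) by cts_tac.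
    apply conv_congr; auto. intros s Hs. rewrite (Heq s) at 1 by auto. ring_simplify. auto. }
  assert (HqM : is_lim (fun t => q t / RInt m 0 t) p_infty 1).
  { apply (is_lim_ext_loc (fun t => conv (fun s => 1 - r s) m t / RInt m 0 t)).
    - exists 0. intros t Ht. rewrite Hq by lra. auto.
    - apply conv_average; auto.
      + cts_tac.
      + intros; left; auto.
      + replace (Finite 1) with (Finite (1 - 0)) by (f_equal; ring). apply is_lim_minus'; [apply is_lim_const|auto].
      + intros A HA. apply (rv_window m (al - 1)); auto; lra. }
  (* The average [q] is at most [K * RInt r 0 t] and eventually at least half of [RInt m 0 t], which
     diverges. Averaging against [r] is possible only after this. *)
  assert (HU : is_lim (RInt r 0) p_infty p_infty).
  { destruct (cts_lim_bounded (conv m lam) B Hcml Hml) as [K [HK Hb]].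
    apply is_lim_spec. intro X. apply is_lim_spec in HMinf.
    pose proof (proj1 (lim_ev _ _) HqM (/ 2) ltac:(lra)) as H1.
    refine (ev_imp _ _ _ (ev_and _ _ (ev_gt 0) (ev_and _ _ H1 (ev_and _ _ HMpos (HMinf (2 * (K * Rabs X))))))).
    intros t [Ht [H2 [H3 H4]]]. apply Rabs_le_between in H2.
    assert (H5 : / 2 <= q t / RInt m 0 t) by lra. apply Rle_div_r in H5; [|lra].
    assert (H6 : q t <= K * RInt r 0 t).
    { change (q t) with (RInt (fun s => conv m lam (t - s) * r s) 0 t).
      rewrite <- RInt_mul_const by auto. apply RInt_mono; [lra|cts_tac|cts_tac|].
      intros s Hs. apply Rmult_le_compat_r; [left; apply Hrp; lra|].
      specialize (Hb (t - s) ltac:(lra)). apply Rabs_le_between in Hb. lra. }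
    apply Rle_lt_trans with (Rabs X); [apply Rle_abs|].
    apply Rmult_lt_reg_l with K; auto. lra. }
  assert (HqU : is_lim (fun t => q t / RInt r 0 t) p_infty B).
  { apply conv_average; auto.
    - intros; left; auto.
    - apply is_lim_spec in HU. apply (HU 0).
    (* A window of length [A] carries at most [A * r 0] since [r] decreases, while the total weight
       diverges. *)
    - intros A HA. apply (is_lim_le_le_loc (fun _ => 0) (fun t => (A * r 0) * / RInt r 0 t)).
      + apply is_lim_spec in HU. destruct (ev_and _ _ (ev_gt A) (HU 0)) as [M HM]. exists M. intros t Ht.
        destruct (HM t Ht) as [H1 H2].
        assert (0 <= RInt r (t - A) t) by (apply RInt_nonneg; [lra|auto|intros; left; apply Hrp; lra]).
        split; [apply Rdiv_le_0_compat; lra|]. apply Rmult_le_compat_r; [left; apply Rinv_0_lt_compat; auto|].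
        replace (A * r 0) with ((t - (t - A)) * r 0) by ring.
        apply RInt_le_cst; [lra|auto|]. intros s Hs. apply Hrd; lra.
      + apply is_lim_const.
      + replace (Finite 0) with (Rbar_mult (A * r 0) 0) by (simpl; rewrite Rmult_0_r; auto).
        apply is_lim_scal_l. apply (is_lim_inv _ _ p_infty); auto. discriminate. }
  assert (HUl : is_lim (fun t => RInt r 0 t * lam t) p_infty (/ B * / al)).
  { apply (is_lim_ext_loc (fun t => (q t / RInt m 0 t) / (q t / RInt r 0 t) * (RInt m 0 t * lam t))).
    - apply is_lim_spec in HU.
      pose proof (proj1 (lim_ev _ _) HqM (/ 2) ltac:(lra)) as H1.
      refine (ev_imp _ _ _ (ev_and _ _ H1 (ev_and _ _ HMpos (HU 0)))).
      intros t [H2 [H3 H4]].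
      assert (q t <> 0).
      { intro H. rewrite H in H2. unfold Rdiv in H2. rewrite Rmult_0_l in H2.
        apply Rabs_le_between in H2. lra. }
      field. repeat split; lra.
    - apply lim_mult; auto. replace (/ B) with (1 / B) by (field; lra). apply lim_div; auto. lra. }
  split; [|split; [exact HU|]].
  - replace (/ B) with (/ B * / al * al) by (field; lra).
    apply monotone_density; auto. apply Rmult_le_pos; left; apply Rinv_0_lt_compat; lra.
  - intros t Ht. apply Rle_trans with (r t * RInt lam 0 t); [|auto].
    apply Rmult_le_compat_l; [left; auto|]. replace t with (t - 0) at 1 by ring.
    apply RInt_ge_cst; auto. intros s Hs. apply Hld; lra.
Qed.

(** * The reflection formula *)

Fixpoint dirichlet (N : nat) (x : R) : R :=
  match N with
  | O => 1
  | S n => dirichlet n x + 2 * cos (INR (S n) * x)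
  end.

Lemma cts_cos c : cts (fun x => cos (c * x)).
Proof. apply (cts_derive _ (fun x => - c * sin (c * x))). intro x. auto_derive; auto. ring. Qed.
Lemma cts_dirichlet N : cts (dirichlet N).
Proof.
  induction N as [|N IH]; [apply cts_const|].
  change (cts (fun x => dirichlet N x + 2 * cos (INR (S N) * x))).
  pose proof (cts_cos (INR (S N))). cts_tac.
Qed.

Lemma dirichlet_sin N x : dirichlet N x * sin (x / 2) = sin ((INR N + / 2) * x).
Proof.
  induction N as [|N IH]; [simpl; rewrite Rmult_1_l; f_equal; field|].
  change (dirichlet (S N) x) with (dirichlet N x + 2 * cos (INR (S N) * x)). rewrite Rmult_plus_distr_r, IH. rewrite S_INR.
  replace ((INR N + / 2) * x) with ((INR N + 1) * x - x / 2) by field.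
  replace ((INR N + 1 + / 2) * x) with ((INR N + 1) * x + x / 2) by field.
  rewrite sin_plus, sin_minus. ring.
Qed.

(* Coquelicot states these equalities in the carrier of [R_CompleteNormedModule], where [ring] and [field] fail. *)
Ltac eq_R := match goal with |- ?a = ?b => change (@eq R a b) end.

Lemma RInt_cos c b : c <> 0 -> RInt (fun x => cos (c * x)) 0 b = sin (c * b) / c.
Proof.
  intro Hc. rewrite (RInt_antiderivative (fun x => cos (c * x)) (fun x => sin (c * x) / c)).
  - rewrite Rmult_0_r, sin_0. eq_R. field; auto.
  - intro x. auto_derive; auto. field; auto.
  - apply cts_cos.
Qed.

Lemma sin_nPI n : sin (INR n * PI) = 0.
Proof.
  induction n; [rewrite Rmult_0_l; apply sin_0|].
  rewrite S_INR, Rmult_plus_distr_r, Rmult_1_l, neg_sin, IHn. ring.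
Qed.
Lemma cos_nPI n : cos (INR n * PI) = (-1) ^ n.
Proof.
  induction n; [rewrite Rmult_0_l; apply cos_0|].
  rewrite S_INR, Rmult_plus_distr_r, Rmult_1_l, neg_cos, IHn. simpl. ring.
Qed.

Lemma RInt_dirichlet N : RInt (dirichlet N) 0 PI = PI.
Proof.
  induction N as [|N IH].
  - change (RInt (fun _ : R => 1) 0 PI = PI). rewrite RInt_cst. eq_R. ring.
  - change (RInt (fun x => dirichlet N x + 2 * cos (INR (S N) * x)) 0 PI = PI).
    pose proof (cts_cos (INR (S N))). pose proof (cts_dirichlet N).
    rewrite RInt_add, RInt_mul_const, IH, RInt_cos, sin_nPI by (cts_tac || (apply not_0_INR; lia)).
    eq_R. unfold Rdiv. ring.
Qed.

(** The [n]-th term contributes [(-1)^n sin (al PI) (1/(n + al) - 1/(n - al))]. The part with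
    [n - al] is moved to index [n - 1], where it has the form and sign of the series; the subtracted
    term is the half of the last summand still lacking its partner. *)
Lemma RInt_cos_dirichlet al N : 0 < al < 1 ->
  RInt (fun x => cos (al * x) * dirichlet N x) 0 PI =
  sin (al * PI) * (sum_f_R0 (fun n => (-1) ^ n * (/ (INR n + al) + / (INR n + 1 - al))) N - (-1) ^ N / (INR N + 1 - al)).
Proof.
  intro Hal. pose proof (cts_cos al) as Hca. induction N as [|N IH].
  - simpl. rewrite (RInt_congr (fun x => cos (al * x) * 1) (fun x => cos (al * x))) by (pose proof PI_RGT_0; lra || (intros; ring)).
    rewrite RInt_cos by lra. eq_R. field. lra.
  - pose proof (pos_INR N). pose proof (cts_dirichlet N) as Hd.
    replace (fun x => cos (al * x) * dirichlet (S N) x) with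
      (fun x => cos (al * x) * dirichlet N x + (cos ((INR (S N) + al) * x) + cos ((INR (S N) - al) * x))).
    2:{ apply functional_extensionality. intro x. change (dirichlet (S N) x) with (dirichlet N x + 2 * cos (INR (S N) * x)).
        rewrite Rmult_plus_distr_r, Rmult_minus_distr_r, cos_plus, cos_minus. ring. }
    pose proof (cts_cos (INR (S N) + al)). pose proof (cts_cos (INR (S N) - al)).
    assert (INR (S N) = INR N + 1) by apply S_INR.
    rewrite RInt_add, RInt_add, IH, !RInt_cos by (cts_tac || lra).
    rewrite Rmult_plus_distr_r, Rmult_minus_distr_r, sin_plus, sin_minus, sin_nPI, cos_nPI.
    rewrite tech5. cbv beta. rewrite H2, <- tech_pow_Rmult. eq_R. field. lra.
Qed.

Lemma sin_abs_le y : 0 <= y -> Rabs (sin y) <= y.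
Proof.
  intro Hy. destruct (MVT_gen sin 0 y cos) as [c [_ Hc]].
  - intros x _. apply is_derive_Reals, derivable_pt_lim_sin.
  - intros x _. apply continuity_sin.
  - rewrite sin_0, !Rminus_0_r in Hc. rewrite Hc, Rabs_mult, (Rabs_pos_eq y) by auto.
    rewrite <- (Rmult_1_l y) at 2. apply Rmult_le_compat_r; auto. apply Rabs_le, COS_bound.
Qed.

Lemma PI_gt_3 : 3 < PI.
Proof. pose proof PI2_3_2. lra. Qed.

Lemma sin_ge_half y : 0 <= y <= 1 -> y / 2 <= sin y.
Proof.
  intro Hy. destruct (MVT_gen sin 0 y cos) as [c [Hc1 Hc]].
  - intros x _. apply is_derive_Reals, derivable_pt_lim_sin.
  - intros x _. apply continuity_sin.
  - rewrite Rmin_left, Rmax_right in Hc1 by lra. rewrite sin_0, !Rminus_0_r in Hc. rewrite Hc.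
    pose proof PI_gt_3. assert (/ 2 <= cos c); [|nra].
    replace (/ 2) with (cos (PI / 3)) by (rewrite cos_PI3; lra). apply cos_decr_1; lra.
Qed.

Lemma one_minus_cos_bounds y : 0 <= y -> 0 <= 1 - cos y <= y * y / 2.
Proof.
  intro Hy. split; [pose proof (COS_bound y); lra|].
  replace y with (2 * (y / 2)) at 1 by field. rewrite cos_2a_sin.
  pose proof (sin_abs_le (y / 2) ltac:(lra)) as H. apply Rabs_le_between in H. nra.
Qed.

(** The kernel is at most [4 / x] in absolute value and [1 - cos (al * x)] at most [x * x / 2], so
    the integrand is bounded by [2 * x], uniformly in [N]. *)
Lemma dirichlet_near_0 al N e : 0 < al < 1 -> 0 < e <= 1 ->
  Rabs (RInt (fun x => (1 - cos (al * x)) * dirichlet N x) 0 e) <= 2 * e.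
Proof.
  intros Hal He. pose proof (cts_cos al). pose proof (cts_dirichlet N).
  apply Rle_trans with ((e - 0) * (2 * e)); [|nra].
  apply RInt_abs_le; [lra|cts_tac|]. intros x Hx.
  pose proof (sin_ge_half (x / 2) ltac:(lra)) as Hs. pose proof (dirichlet_sin N x) as Hd.
  pose proof (one_minus_cos_bounds (al * x) ltac:(nra)) as Hc.
  rewrite Rabs_mult, (Rabs_pos_eq (1 - cos (al * x))) by lra.
  assert (HD : Rabs (dirichlet N x) * sin (x / 2) <= 1).
  { rewrite <- (Rabs_pos_eq (sin (x / 2))) by lra. rewrite <- Rabs_mult, Hd. apply Rabs_le, SIN_bound. }
  pose proof (Rabs_pos (dirichlet N x)) as HDp.
  assert (Rabs (dirichlet N x) * (x / 4) <= 1).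
  { apply Rle_trans with (Rabs (dirichlet N x) * sin (x / 2)); auto. apply Rmult_le_compat_l; lra. }
  assert (Hax : al * x * (al * x) <= x * x) by (apply Rmult_le_compat; nra).
  assert (Hcx : 1 - cos (al * x) <= x * x / 2) by lra.
  apply Rle_trans with (x * x / 2 * Rabs (dirichlet N x)).
  - apply Rmult_le_compat_r; auto.
  - replace (x * x / 2 * Rabs (dirichlet N x)) with (2 * x * (Rabs (dirichlet N x) * (x / 4))) by field. nra.
Qed.

(* Integration by parts against [sin ((N + 1/2) x)], in the form of a mean value estimate. *)
Lemma dirichlet_away_0 al N e : 0 < al < 1 -> 0 < e <= 1 ->
  Rabs (RInt (fun x => (1 - cos (al * x)) * dirichlet N x) e PI) <=
    (4 / sin (e / 2) + 2 * PI / (sin (e / 2) * sin (e / 2))) / (INR N + / 2).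
Proof.
  intros Hal He. pose proof (cts_cos al) as Hca. pose proof (cts_dirichlet N) as Hd. pose proof PI_gt_3 as HPI.
  set (M := INR N + / 2). assert (HM : 0 < M) by (unfold M; pose proof (pos_INR N); lra).
  set (c := sin (e / 2)).
  assert (Hcp : 0 < c) by (apply sin_gt_0; lra).
  assert (Hsin : forall x, e <= x <= PI -> c <= sin (x / 2)) by (intros x Hx; apply sin_incr_1; lra).
  set (phi := fun x => (1 - cos (al * x)) / sin (x / 2)).
  set (dphi := fun x => (al * sin (al * x) * sin (x / 2) - (1 - cos (al * x)) * (cos (x / 2) / 2)) / (sin (x / 2) * sin (x / 2))).
  assert (Hphi : forall x, e <= x <= PI -> Rabs (phi x) <= 2 / c).
  { intros x Hx. specialize (Hsin x Hx). unfold phi, Rdiv. rewrite Rabs_mult, Rabs_inv, (Rabs_pos_eq (sin _)) by lra.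
    apply Rmult_le_compat; [apply Rabs_pos|left; apply Rinv_0_lt_compat; lra| |apply Rinv_le_contravar; lra].
    pose proof (COS_bound (al * x)). apply Rabs_le. lra. }
  assert (Hdphi : forall x, e <= x <= PI -> Rabs (dphi x) <= 2 / (c * c)).
  { intros x Hx. specialize (Hsin x Hx). unfold dphi, Rdiv at 1.
    assert (0 < sin (x / 2) * sin (x / 2)) by nra.
    rewrite Rabs_mult, Rabs_inv, (Rabs_pos_eq (sin _ * sin _)) by lra.
    apply Rmult_le_compat; [apply Rabs_pos|left; apply Rinv_0_lt_compat; lra| |apply Rinv_le_contravar; nra].
    pose proof (COS_bound (al * x)). pose proof (SIN_bound (al * x)).
    pose proof (COS_bound (x / 2)). pose proof (SIN_bound (x / 2)).
    unfold Rminus at 1. eapply Rle_trans; [apply Rabs_triang|]. rewrite Rabs_Ropp, !Rabs_mult.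
    assert (Rabs (sin (al * x)) <= 1) by (apply Rabs_le; lra).
    assert (Rabs (sin (x / 2)) <= 1) by (apply Rabs_le; lra).
    assert (Rabs (1 - cos (al * x)) <= 2) by (apply Rabs_le; lra).
    assert (Rabs (cos (x / 2) / 2) <= / 2) by (apply Rabs_le; lra).
    rewrite (Rabs_pos_eq al) by lra.
    assert (al * Rabs (sin (al * x)) * Rabs (sin (x / 2)) <= 1 * 1 * 1).
    { apply Rmult_le_compat; try apply Rabs_pos; auto; [apply Rmult_le_pos; [lra|apply Rabs_pos]|].
      apply Rmult_le_compat; try apply Rabs_pos; lra. }
    assert (Rabs (1 - cos (al * x)) * Rabs (cos (x / 2) / 2) <= 2 * / 2).
    { apply Rmult_le_compat; try apply Rabs_pos; auto. }
    lra. }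
  set (f := fun x => (1 - cos (al * x)) * dirichlet N x).
  assert (Hf : cts f) by (unfold f; cts_tac).
  (* On this range [f x = phi x * sin (M * x)]; adding [phi x * cos (M * x) / M] cancels it and
     leaves the derivative [dphi x * cos (M * x) / M], of order [1 / M]. *)
  destruct (MVT_gen (fun x => RInt f e x + phi x * cos (M * x) / M) e PI (fun x => dphi x * cos (M * x) / M)) as [x [Hx E]].
  - rewrite Rmin_left, Rmax_right by lra. intros x Hx. specialize (Hsin x ltac:(lra)).
    assert (Hfx : f x = phi x * sin (M * x)).
    { unfold f, phi, M. rewrite <- dirichlet_sin. field. lra. }
    replace (dphi x * cos (M * x) / M) with (f x + (dphi x * cos (M * x) - phi x * M * sin (M * x)) / M)
      by (rewrite Hfx; field; lra).
    apply (is_derive_plus (K:=R_AbsRing) (V:=R_NormedModule) (fun x => RInt f e x)); [apply derive_RInt; auto|].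
    assert (Hne : sin (x / 2) <> 0) by lra. unfold phi, dphi. auto_derive; [repeat split; exact Hne|]. unfold Rdiv. field. lra.
  - rewrite Rmin_left, Rmax_right by lra. intros x Hx. specialize (Hsin x ltac:(lra)).
    apply continuity_pt_filterlim.
    apply (continuous_plus (U:=R_UniformSpace) (K:=R_AbsRing) (V:=R_NormedModule) (fun x => RInt f e x) (fun x => phi x * cos (M * x) / M));
      [apply cts_RInt; auto|].
    apply (ex_derive_continuous (K:=R_AbsRing) (V:=R_NormedModule)). assert (Hne : sin (x / 2) <> 0) by lra.
    unfold phi. auto_derive. repeat split; exact Hne.
  - rewrite Rmin_left, Rmax_right in Hx by lra. rewrite RInt_same in E.
    assert (Hb : forall y, e <= y <= PI -> Rabs (phi y * cos (M * y) / M) <= 2 / c / M).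
    { intros y Hy. unfold Rdiv at 1. rewrite !Rabs_mult, Rabs_inv, (Rabs_pos_eq M) by lra.
      apply Rmult_le_compat_r; [left; apply Rinv_0_lt_compat; auto|].
      specialize (Hphi y Hy). pose proof (COS_bound (M * y)).
      assert (Rabs (cos (M * y)) <= 1) by (apply Rabs_le; lra).
      rewrite <- (Rmult_1_r (2 / c)). apply Rmult_le_compat; auto; apply Rabs_pos. }
    assert (Hb1 := Hb e ltac:(lra)). assert (Hb2 := Hb PI ltac:(lra)).
    assert (Hb3 : Rabs (dphi x * cos (M * x) / M * (PI - e)) <= 2 / (c * c) / M * PI).
    { unfold Rdiv at 1. rewrite !Rabs_mult, Rabs_inv, (Rabs_pos_eq M), (Rabs_pos_eq (PI - e)) by lra.
      assert (Rabs (cos (M * x)) <= 1) by (apply Rabs_le, COS_bound).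
      assert (0 < / M) by (apply Rinv_0_lt_compat; auto).
      assert (0 <= Rabs (dphi x) * Rabs (cos (M * x))) by (apply Rmult_le_pos; apply Rabs_pos).
      apply Rmult_le_compat; [apply Rmult_le_pos; lra|lra| |lra].
      apply Rmult_le_compat_r; [lra|]. specialize (Hdphi x Hx).
      rewrite <- (Rmult_1_r (2 / (c * c))). apply Rmult_le_compat; auto; apply Rabs_pos. }
    replace ((4 / c + 2 * PI / (c * c)) / M) with (2 / c / M + 2 / c / M + 2 / (c * c) / M * PI) by (field; lra).
    apply Rabs_le_between in Hb1. apply Rabs_le_between in Hb2. apply Rabs_le_between in Hb3.
    apply Rabs_le. lra.
Qed.

(** The kernel has integral [PI], so [PI] minus the integral of [cos (al * x)] against it is the
    integral of [1 - cos (al * x)] against it. That factor vanishes at 0 to second order, so this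
    integral tends to 0 with [1 / N]. *)
Lemma cosecant_series al eps : 0 < al < 1 -> 0 < eps -> exists N0, forall N, (N0 <= N)%nat ->
  Rabs (sin (al * PI) * sum_f_R0 (fun n => (-1) ^ n * (/ (INR n + al) + / (INR n + 1 - al))) N - PI) <= eps.
Proof.
  intros Hal He. pose proof PI_gt_3 as HPI.
  set (e := Rmin 1 (eps / 4)).
  assert (He1 : 0 < e <= 1 /\ e <= eps / 4).
  { repeat split; [apply Rmin_pos; lra | apply Rmin_l | apply Rmin_r]. }
  assert (Hc : 0 < sin (e / 2)) by (apply sin_gt_0; lra).
  set (C := 4 / sin (e / 2) + 2 * PI / (sin (e / 2) * sin (e / 2))).
  assert (HC : 0 < C).
  { unfold C. apply Rplus_lt_0_compat; apply Rdiv_lt_0_compat; try lra. apply Rmult_lt_0_compat; lra. }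
  (* The error [eps] is shared out: [eps / 2] near 0 through [e], [eps / 4] away from 0 through
     [4 * C / eps], and [eps / 4] for the unpaired term through [4 / eps]. *)
  destruct (INR_unbounded (4 * C / eps + 4 / eps + 1)) as [N0 HN0].
  exists (S N0). intros N HN. apply le_INR in HN. rewrite S_INR in HN.
  pose proof (RInt_cos_dirichlet al N Hal) as E1. pose proof (RInt_dirichlet N) as E2.
  pose proof (cts_cos al) as Hca. pose proof (cts_dirichlet N) as Hd.
  set (SN := sum_f_R0 (fun n => (-1) ^ n * (/ (INR n + al) + / (INR n + 1 - al))) N) in *.
  assert (E3 : RInt (fun x => (1 - cos (al * x)) * dirichlet N x) 0 PI = PI - sin (al * PI) * (SN - (-1) ^ N / (INR N + 1 - al))).
  { rewrite <- E1. rewrite <- E2 at 2. rewrite <- RInt_sub by cts_tac. f_equal.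
    apply functional_extensionality; intro; ring. }
  assert (Hcc : cts (fun x => (1 - cos (al * x)) * dirichlet N x)) by cts_tac.
  rewrite <- (RInt_split _ 0 e PI Hcc) in E3.
  pose proof (dirichlet_near_0 al N e Hal (proj1 He1)) as B1.
  pose proof (dirichlet_away_0 al N e Hal (proj1 He1)) as B2. fold C in B2.
  assert (H4e : 0 < 4 / eps) by (apply Rdiv_lt_0_compat; lra).
  assert (H4C : 0 < 4 * C / eps) by (apply Rdiv_lt_0_compat; lra).
  assert (B3 : C / (INR N + / 2) <= eps / 4).
  { apply (Rle_div_l _ _ (INR N + / 2)); [lra|].
    apply Rle_trans with (eps / 4 * (4 * C / eps)); [right; field; lra|]. apply Rmult_le_compat_l; lra. }
  assert (B4 : Rabs (sin (al * PI) * ((-1) ^ N / (INR N + 1 - al))) <= eps / 4).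
  { unfold Rdiv. rewrite !Rabs_mult, Rabs_inv, pow_1_abs, Rmult_1_l, (Rabs_pos_eq (INR N + 1 - al)) by lra.
    apply Rle_trans with (1 * / (4 / eps)).
    - apply Rmult_le_compat; [apply Rabs_pos|left; apply Rinv_0_lt_compat; lra|apply Rabs_le, SIN_bound|].
      apply Rinv_le_contravar; lra.
    - right. field. lra. }
  rewrite Rmult_minus_distr_l in E3.
  apply Rabs_le_between in B1. apply Rabs_le_between in B2. apply Rabs_le_between in B4. apply Rabs_le. lra.
Qed.

(** * The beta integral as an alternating series *)

Lemma cts_exp c : cts (fun y => exp (c * y)).
Proof. apply (cts_derive _ (fun x => c * exp (c * x))). intro x. auto_derive; auto. ring. Qed.

Lemma RInt_exp q Y : q <> 0 -> RInt (fun y => exp (- q * y)) 0 Y = (1 - exp (- q * Y)) / q.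
Proof.
  intro Hq. rewrite (RInt_antiderivative (fun y => exp (- q * y)) (fun y => - exp (- q * y) / q)).
  - rewrite Rmult_0_r, exp_0. eq_R. field; auto.
  - intro x. auto_derive; auto. field; auto.
  - apply cts_exp.
Qed.

(** The beta integrand on one half-line after the substitution [u = e^y / (1 + e^y)], with [p] equal
    to [al] or [1 - al]. *)
Definition logistic_tail (p y : R) : R := exp (- p * y) / (1 + exp (- 1 * y)).

Lemma cts_logistic_tail p : cts (logistic_tail p).
Proof.
  unfold logistic_tail, Rdiv. pose proof (cts_exp (- p)). pose proof (cts_exp (- 1)).
  apply cts_mult; auto. apply cts_inv; [cts_tac|]. intro y. pose proof (exp_pos (- 1 * y)). lra.
Qed.

(** Geometric expansion of [1 / (1 + e^(-y))] with an exact remainder, from the recursion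
    [logistic_tail q y = exp (- q * y) - logistic_tail (q + 1) y]. *)
Lemma logistic_tail_expand p N y : logistic_tail p y =
  sum_f_R0 (fun n => (-1) ^ n * exp (- (INR n + p) * y)) N + (-1) ^ S N * logistic_tail (INR (S N) + p) y.
Proof.
  assert (Hstep : forall q, logistic_tail q y = exp (- q * y) - logistic_tail (q + 1) y).
  { intro q. unfold logistic_tail. pose proof (exp_pos (- 1 * y)).
    replace (- (q + 1) * y) with (- q * y + - 1 * y) by ring. rewrite exp_plus. field. lra. }
  induction N as [|N IH].
  - simpl. rewrite (Hstep p). replace (0 + p) with p by ring. replace (1 + p) with (p + 1) by ring. ring.
  - rewrite IH, tech5, (Hstep (INR (S N) + p)). rewrite (S_INR (S N)).
    replace (INR (S N) + p + 1) with (INR (S N) + 1 + p) by ring. simpl pow. ring.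
Qed.

(** The first error is the integrated remainder, at most the inverse of [INR (S N) + p]; the second
    bounds the [N + 1] effects of stopping at [Y]. Keeping both explicit allows [N] to be fixed
    before [Y]. *)
Lemma RInt_logistic_tail_series p N Y : 0 < p -> 0 <= Y ->
  Rabs (RInt (logistic_tail p) 0 Y - sum_f_R0 (fun n => (-1) ^ n * / (INR n + p)) N)
   <= / (INR N + 1) + (INR N + 1) * (exp (- p * Y) / p).
Proof.
  intros Hp HY.
  assert (Hpos : forall n, 0 < INR n + p) by (intro n; pose proof (pos_INR n); lra).
  assert (Hc : forall N, cts (fun y => sum_f_R0 (fun n => (-1) ^ n * exp (- (INR n + p) * y)) N)).
  { induction N0 as [|M IH]; simpl.
    - pose proof (cts_exp (- (0 + p))). cts_tac.
    - pose proof (cts_exp (- ((match M with O => 1 | S _ => INR M + 1 end) + p))). cts_tac. }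
  assert (Hs : forall N, RInt (fun y => sum_f_R0 (fun n => (-1) ^ n * exp (- (INR n + p) * y)) N) 0 Y
     = sum_f_R0 (fun n => (-1) ^ n * ((1 - exp (- (INR n + p) * Y)) / (INR n + p))) N).
  { induction N0 as [|M IH].
    - change (RInt (fun y => (-1) ^ 0 * exp (- (INR 0 + p) * y)) 0 Y =
        (-1) ^ 0 * ((1 - exp (- (INR 0 + p) * Y)) / (INR 0 + p))).
      rewrite RInt_mul_const, RInt_exp by (apply cts_exp || apply Rgt_not_eq, Hpos). auto.
    - rewrite tech5, <- IH.
      rewrite <- RInt_exp by (apply Rgt_not_eq, Hpos). pose proof (cts_exp (- (INR (S M) + p))) as He.
      rewrite <- RInt_mul_const, <- RInt_add by (cts_tac || apply Hc). auto. }
  assert (Hd : forall N, Rabs (sum_f_R0 (fun n => (-1) ^ n * ((1 - exp (- (INR n + p) * Y)) / (INR n + p))) N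
     - sum_f_R0 (fun n => (-1) ^ n * / (INR n + p)) N) <= (INR N + 1) * (exp (- p * Y) / p)).
  { intro N0. rewrite <- minus_sum. eapply Rle_trans; [apply Rsum_abs|].
    replace ((INR N0 + 1) * (exp (- p * Y) / p)) with (sum_f_R0 (fun _ => exp (- p * Y) / p) N0)
      by (rewrite sum_cte, S_INR; ring).
    apply sum_Rle. intros n _. specialize (Hpos n).
    replace ((-1) ^ n * ((1 - exp (- (INR n + p) * Y)) / (INR n + p)) - (-1) ^ n * / (INR n + p))
      with ((-1) ^ n * (- (exp (- (INR n + p) * Y) / (INR n + p)))) by (field; lra).
    rewrite Rabs_mult, pow_1_abs, Rmult_1_l, Rabs_Ropp.
    rewrite Rabs_pos_eq by (apply Rdiv_le_0_compat; [left; apply exp_pos|lra]).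
    pose proof (pos_INR n).
    apply Rmult_le_compat; [left; apply exp_pos|left; apply Rinv_0_lt_compat; lra| |apply Rinv_le_contravar; lra].
    assert (Hle : - (INR n + p) * Y <= - p * Y) by nra.
    destruct Hle as [Hle|Hle]; [left; apply exp_increasing; auto|rewrite Hle; lra]. }
  assert (Hr : Rabs ((-1) ^ S N * RInt (logistic_tail (INR (S N) + p)) 0 Y) <= / (INR N + 1)).
  { rewrite Rabs_mult, pow_1_abs, Rmult_1_l.
    assert (Hq := Hpos (S N)). set (q := INR (S N) + p) in *.
    assert (Hlt : forall y, 0 <= logistic_tail q y <= exp (- q * y)).
    { intro y. unfold logistic_tail. pose proof (exp_pos (- q * y)). pose proof (exp_pos (- 1 * y)).
      split; [apply Rdiv_le_0_compat; lra|]. apply (Rle_div_l _ _ (1 + exp (- 1 * y))); nra. }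
    pose proof (cts_logistic_tail q) as Hcq. pose proof (cts_exp (- q)) as Hce.
    rewrite Rabs_pos_eq by (apply RInt_nonneg; auto; intros; apply Hlt).
    apply Rle_trans with (RInt (fun y => exp (- q * y)) 0 Y); [apply RInt_mono; auto; intros; apply Hlt|].
    rewrite RInt_exp by lra. apply Rle_trans with (/ q).
    - rewrite <- (Rmult_1_l (/ q)). apply Rmult_le_compat_r; [left; apply Rinv_0_lt_compat; auto|].
      pose proof (exp_pos (- q * Y)). lra.
    - apply Rinv_le_contravar; [pose proof (pos_INR N); lra|]. unfold q. rewrite S_INR. lra. }
  specialize (Hd N).
  assert (E : RInt (logistic_tail p) 0 Y = sum_f_R0 (fun n => (-1) ^ n * ((1 - exp (- (INR n + p) * Y)) / (INR n + p))) N
    + (-1) ^ S N * RInt (logistic_tail (INR (S N) + p)) 0 Y).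
  { pose proof (cts_logistic_tail (INR (S N) + p)) as Hcq.
    rewrite <- Hs, <- RInt_mul_const, <- RInt_add by (cts_tac || apply Hc). f_equal.
    apply functional_extensionality. intro y. apply logistic_tail_expand. }
  rewrite E. apply Rabs_le_between in Hd. apply Rabs_le_between in Hr. apply Rabs_le. lra.
Qed.

(** With [du = u (1 - u) dy] the integrand becomes [e^((1 - al) y) / (1 + e^y)], and the symmetric
    cut of [[0, 1]] becomes [[- Y, Y]]. The negative half, reflected, is the tail for [1 - al]; the
    positive half is the tail for [al]. *)
Lemma beta_integral_logistic al Y : 0 < al < 1 -> 0 <= Y ->
  RInt (fun u => Rpower (1 - u) (al - 1) * Rpower u (- al)) (/ (1 + exp Y)) (1 - / (1 + exp Y)) =
  RInt (logistic_tail (1 - al)) 0 Y + RInt (logistic_tail al) 0 Y.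
Proof.
  intros Hal HY.
  set (sg := fun y => exp y / (1 + exp y)).
  set (f := fun u => Rpower (1 - u) (al - 1) * Rpower u (- al)).
  assert (Hsg : forall y, 0 < sg y < 1).
  { intro y. unfold sg. pose proof (exp_pos y). split; [apply Rdiv_lt_0_compat; lra|].
    apply (Rlt_div_l _ _ (1 + exp y)); lra. }
  assert (Hdsg : forall y, is_derive sg y (sg y * (1 - sg y))).
  { intro y. unfold sg. pose proof (exp_pos y). auto_derive; [lra|]. field. lra. }
  assert (Hcsg : cts sg) by (apply (cts_derive sg (fun y => sg y * (1 - sg y))); auto).
  assert (E : RInt (fun y => sg y * (1 - sg y) * f (sg y)) (- Y) Y = RInt f (sg (- Y)) (sg Y)).
  { apply (RInt_comp (V:=R_CompleteNormedModule) f sg (fun y => sg y * (1 - sg y))).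
    - intros y _. specialize (Hsg y). unfold f.
      apply (continuous_mult (K:=R_AbsRing) (fun u => Rpower (1 - u) (al - 1)) (fun u => Rpower u (- al))).
      + apply (continuous_comp (fun u => 1 - u) (fun v => Rpower v (al - 1))).
        * assert (Hc1 : cts (fun u => 1 - u)) by cts_tac. apply Hc1.
        * apply continuous_Rpower. lra.
      + apply continuous_Rpower. lra.
    - intros y _. split; auto. assert (Hc1 : cts (fun y => sg y * (1 - sg y))) by cts_tac. apply Hc1. }
  assert (Hg : forall y, sg y * (1 - sg y) * f (sg y) = exp ((1 - al) * y) / (1 + exp y)).
  { intro y. pose proof (exp_pos y) as Hy. set (L := ln (1 + exp y)).
    assert (HL : 1 + exp y = exp L) by (unfold L; rewrite exp_ln; lra).
    assert (H1 : sg y = exp (y - L)) by (unfold sg; rewrite HL; unfold Rminus; rewrite exp_plus, exp_Ropp; auto).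
    assert (H2 : 1 - sg y = exp (- L)).
    { unfold sg. rewrite exp_Ropp, <- HL. field. lra. }
    unfold f, Rpower. rewrite H2, H1, !ln_exp, HL. unfold Rdiv. rewrite <- exp_Ropp, <- !exp_plus.
    f_equal. ring. }
  assert (Hc : cts (fun y => exp ((1 - al) * y) / (1 + exp y))).
  { pose proof (cts_exp (1 - al)) as H1. apply cts_mult; auto. apply cts_inv.
    - apply cts_plus; [apply cts_const|]. intro; apply continuous_exp.
    - intro y. pose proof (exp_pos y). lra. }
  replace (/ (1 + exp Y)) with (sg (- Y)).
  2:{ unfold sg. rewrite exp_Ropp. pose proof (exp_pos Y). field. lra. }
  replace (1 - sg (- Y)) with (sg Y).
  2:{ unfold sg. rewrite exp_Ropp. pose proof (exp_pos Y). field. lra. }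
  fold f. rewrite <- E.
  replace (fun y => sg y * (1 - sg y) * f (sg y)) with (fun y => exp ((1 - al) * y) / (1 + exp y))
    by (apply functional_extensionality; intro; symmetry; apply Hg).
  rewrite <- (RInt_split _ (- Y) 0 Y Hc). f_equal.
  - pose proof (RInt_affine _ (-1) 0 Y 0 Hc) as E2.
    replace (-1 * Y + 0) with (- Y) in E2 by ring. replace (-1 * 0 + 0) with 0 in E2 by ring.
    rewrite <- E2.
    pose proof (cts_logistic_tail (1 - al)) as Hl.
    pose proof (RInt_split _ 0 Y 0 Hl) as E3. rewrite RInt_same in E3.
    replace (fun y => -1 * (exp ((1 - al) * (-1 * y + 0)) / (1 + exp (-1 * y + 0)))) with (fun y => -1 * logistic_tail (1 - al) y).
    + rewrite RInt_mul_const by auto. lra.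
    + apply functional_extensionality. intro y. unfold logistic_tail. rewrite Rplus_0_r. do 3 f_equal. ring.
  - f_equal. apply functional_extensionality. intro y. unfold logistic_tail.
    replace ((1 - al) * y) with (- al * y + y) by ring. rewrite exp_plus.
    replace (- 1 * y) with (- y) by ring. rewrite exp_Ropp. pose proof (exp_pos y). field. lra.
Qed.

(** The two alternating series for [al] and [1 - al] add up termwise to the cosecant series. Its
    length [N] is chosen from [eps] alone, and only then the cut, through [Y0], small enough in
    terms of [N]. *)
Lemma is_beta_sin al : 0 < al < 1 -> is_beta (al - 1) (- al) (PI / sin (al * PI)).
Proof.
  intros Hal eps He. pose proof PI_gt_3 as HPI.
  assert (Hs : 0 < sin (al * PI)) by (apply sin_gt_0; nra).
  assert (Hs1 : sin (al * PI) <= 1) by apply SIN_bound.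
  set (s := sin (al * PI)) in *.
  assert (Hse : 0 < s * eps) by (apply Rmult_lt_0_compat; auto).
  destruct (cosecant_series al (s * eps / 4) Hal ltac:(lra)) as [N0 HN0].
  destruct (INR_unbounded (8 / (s * eps))) as [N1 HN1].
  set (N := max N0 N1). specialize (HN0 N (Nat.le_max_l _ _)).
  assert (HN : INR N1 <= INR N) by (apply le_INR, Nat.le_max_r).
  assert (Hq : 0 < 8 / (s * eps)) by (apply Rdiv_lt_0_compat; lra).
  set (p := Rmin al (1 - al)).
  assert (Hp : 0 < p /\ p <= al /\ p <= 1 - al).
  { repeat split; [apply Rmin_pos; lra|apply Rmin_l|apply Rmin_r]. }
  (* Once [exp (- p * Y) <= b], the [N + 1] truncation errors of each series total at most
     [s * eps / 8]. *)
  set (b := s * eps * p / (8 * (INR N + 1))).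
  assert (Hb : 0 < b).
  { apply Rdiv_lt_0_compat; [apply Rmult_lt_0_compat; lra|lra]. }
  set (Y0 := Rmax 0 (- ln b / p)).
  assert (HY0 : 0 <= Y0) by apply Rmax_l.
  assert (HY0b : - ln b / p <= Y0) by apply Rmax_r.
  pose proof (exp_pos Y0) as HeY.
  (* Using [2 + exp Y0] instead of [1 + exp Y0] keeps [d0] strictly below [/ 2] even when
     [Y0 = 0]. *)
  assert (Hd0 : 0 < / (2 + exp Y0) < / 2).
  { split; [apply Rinv_0_lt_compat; lra|]. apply Rinv_lt_contravar; lra. }
  exists (/ (2 + exp Y0)). split; [auto|]. intros d Hd.
  assert (Hdi : 2 + exp Y0 <= / d).
  { rewrite <- (Rinv_inv (2 + exp Y0)). apply Rinv_le_contravar; lra. }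
  set (Y := ln (/ d - 1)).
  assert (HY : exp Y = / d - 1) by (unfold Y; apply exp_ln; lra).
  assert (HYY : Y0 <= Y).
  { apply Rnot_lt_le. intro H. apply exp_increasing in H. lra. }
  replace d with (/ (1 + exp Y)) by (rewrite HY; field; lra).
  rewrite beta_integral_logistic by lra.
  assert (Hsmall : forall p', p <= p' -> exp (- p' * Y) / p' <= s * eps / (8 * (INR N + 1))).
  { intros p' Hp'. apply (Rle_div_l _ _ p'); [lra|].
    apply Rle_trans with b.
    - rewrite <- (exp_ln b) by auto.
      assert (Hle : - p' * Y <= ln b).
      { apply (Rle_div_l _ _ p) in HY0b; [|lra]. nra. }
      destruct Hle as [Hle|Hle]; [left; apply exp_increasing; auto|rewrite Hle; lra].
    - unfold b. replace (s * eps * p / (8 * (INR N + 1))) with (s * eps / (8 * (INR N + 1)) * p) by (field; lra).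
      apply Rmult_le_compat_l; [|lra]. left. apply Rdiv_lt_0_compat; lra. }
  pose proof (RInt_logistic_tail_series al N Y ltac:(lra) ltac:(lra)) as H1.
  pose proof (RInt_logistic_tail_series (1 - al) N Y ltac:(lra) ltac:(lra)) as H2.
  assert (H3 := Hsmall al ltac:(lra)). assert (H4 := Hsmall (1 - al) ltac:(lra)).
  apply (Rmult_le_compat_l (INR N + 1)) in H3; [|lra]. apply (Rmult_le_compat_l (INR N + 1)) in H4; [|lra].
  replace ((INR N + 1) * (s * eps / (8 * (INR N + 1)))) with (s * eps / 8) in H3, H4 by (field; lra).
  assert (H5 : / (INR N + 1) <= s * eps / 8).
  { rewrite <- (Rinv_inv (s * eps / 8)). apply Rinv_le_contravar; [apply Rinv_0_lt_compat; lra|].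
    replace (/ (s * eps / 8)) with (8 / (s * eps)) by (field; lra). lra. }
  set (I1 := RInt (logistic_tail al) 0 Y) in *. set (I2 := RInt (logistic_tail (1 - al)) 0 Y) in *.
  assert (Hsum : sum_f_R0 (fun n => (-1) ^ n * (/ (INR n + al) + / (INR n + 1 - al))) N =
    sum_f_R0 (fun n => (-1) ^ n * / (INR n + al)) N + sum_f_R0 (fun n => (-1) ^ n * / (INR n + (1 - al))) N).
  { rewrite <- plus_sum. apply sum_eq. intros n _.
    replace (INR n + (1 - al)) with (INR n + 1 - al) by ring. ring. }
  rewrite Hsum in HN0. fold s in HN0.
  set (S1 := sum_f_R0 (fun n => (-1) ^ n * / (INR n + al)) N) in *.
  set (S2 := sum_f_R0 (fun n => (-1) ^ n * / (INR n + (1 - al))) N) in *.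
  replace (I2 + I1 - PI / s) with ((s * ((I2 - S2) + (I1 - S1)) + (s * (S1 + S2) - PI)) / s) by (field; lra).
  unfold Rdiv. rewrite Rabs_mult, Rabs_inv, (Rabs_pos_eq s) by lra. apply (Rle_div_l _ _ s); [lra|].
  eapply Rle_trans; [apply Rabs_triang|]. rewrite Rabs_mult, (Rabs_pos_eq s) by lra.
  assert (H6 : Rabs (I2 - S2 + (I1 - S1)) <= s * eps / 2).
  { eapply Rle_trans; [apply Rabs_triang|]. lra. }
  assert (s * Rabs (I2 - S2 + (I1 - S1)) <= 1 * (s * eps / 2)) by (apply Rmult_le_compat; try lra; apply Rabs_pos).
  lra.
Qed.

(** * Square integrability and the theorem *)

(* Over dyadic blocks [RInt (fun s => r s ^ 2) t (2 * t) <= / (t * lam t ^ 2)], and the right-hand side decays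
   geometrically in the block number because [2 * al < 1]. *)
Lemma square_integral_bounded lam r al : cts lam -> cts r -> (forall t, 0 < lam t) ->
  (forall t, 0 <= t -> 0 < r t) -> (forall s t, 0 <= s <= t -> r t <= r s) ->
  reg_var lam (- al) -> 0 < al < / 2 -> (forall t, 0 <= t -> r t * (t * lam t) <= 1) ->
  exists C, forall t, 0 <= t -> RInt (fun s => r s ^ 2) 0 t <= C.
Proof.
  intros Hlc Hrc Hlp Hrp Hrd Hh Hal Hb.
  assert (Hg : forall t, 0 < lam t * lam t) by (intro t; apply Rmult_lt_0_compat; auto).
  assert (Hhg := rv_mult lam lam _ _ Hlp Hlp Hh Hh).
  destruct (rv_half_bounds (fun t => lam t * lam t) (- al + - al) Hg ltac:(lra) Hhg) as [th [Hth [M0 HM0]]].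
  set (M := Rmax 1 (M0 + 1)).
  assert (HM1 : 1 <= M) by apply Rmax_l. assert (HMM : M0 < M) by (pose proof (Rmax_r 1 (M0 + 1)); fold M in H; lra).
  assert (Hc : cts (fun s => r s ^ 2)) by cts_tac.
  set (w := fun t => / (t * (lam t * lam t))).
  assert (Hwp : forall t, 0 < t -> 0 < w t) by (intros t Ht; apply Rinv_0_lt_compat, Rmult_lt_0_compat; auto).
  set (F := fun t => RInt (fun s => r s ^ 2) 0 t).
  assert (Hmono : forall s t, s <= t -> F s <= F t).
  { intros s t Hst. unfold F. rewrite <- (RInt_split _ 0 s t Hc).
    assert (0 <= RInt (fun s => r s ^ 2) s t); [|lra]. apply RInt_nonneg; auto. intros; apply pow2_ge_0. }
  (* A potential argument: one block adds at most [w t] to [F], while [w (2 * t) <= th * w t]; the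
     weight [/ (1 - th)], the sum of the geometric series, makes [F + / (1 - th) * w] nonincreasing
     along doublings. *)
  assert (Hstep : forall t, M <= t -> F (2 * t) + / (1 - th) * w (2 * t) <= F t + / (1 - th) * w t).
  { intros t Ht. pose proof (Hlp t) as Hlt.
    assert (H1 : F (2 * t) <= F t + w t).
    { unfold F. rewrite <- (RInt_split _ 0 t (2 * t) Hc).
      assert (RInt (fun s => r s ^ 2) t (2 * t) <= (2 * t - t) * r t ^ 2).
      { apply RInt_le_cst; [lra|auto|]. intros s Hs. apply pow_incr. split; [left; apply Hrp; lra|apply Hrd; lra]. }
      assert ((2 * t - t) * r t ^ 2 <= w t); [|lra].
      assert (Htl : 0 < t * lam t) by (apply Rmult_lt_0_compat; lra).
      assert (Hrt : 0 <= r t * (t * lam t) <= 1).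
      { split; [apply Rmult_le_pos; [left; apply Hrp; lra|lra]|apply Hb; lra]. }
      replace ((2 * t - t) * r t ^ 2) with ((r t * (t * lam t)) * (r t * (t * lam t)) * w t) by (unfold w; field; lra).
      rewrite <- (Rmult_1_l (w t)) at 2. apply Rmult_le_compat_r; [left; apply Hwp; lra|]. nra. }
    assert (H2 : w (2 * t) <= th * w t).
    { destruct (HM0 (2 * t)) as [Ha _]; [lra|]. replace (2 * t * / 2) with t in Ha by field.
      unfold w. pose proof (Hg (2 * t)). pose proof (Hg t).
      replace (th * / (t * (lam t * lam t))) with (/ (t * (lam t * lam t) / th)) by (field; lra).
      apply Rinv_le_contravar; [apply Rdiv_lt_0_compat; [apply Rmult_lt_0_compat; lra|lra]|].
      apply (Rle_div_l _ _ th); [lra|].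
      replace (2 * t * (lam (2 * t) * lam (2 * t)) * th) with (t * (2 * th * (lam (2 * t) * lam (2 * t)))) by ring.
      apply Rmult_le_compat_l; lra. }
    assert (H3 : / (1 - th) * w (2 * t) <= / (1 - th) * (th * w t)).
    { apply Rmult_le_compat_l; auto. left. apply Rinv_0_lt_compat. lra. }
    replace (/ (1 - th) * (th * w t)) with (/ (1 - th) * w t - w t) in H3 by (field; lra). lra. }
  assert (Hin : forall n, F (M * 2 ^ n) + / (1 - th) * w (M * 2 ^ n) <= F M + / (1 - th) * w M).
  { induction n as [|n IH]; [simpl; rewrite Rmult_1_r; lra|].
    assert (1 <= 2 ^ n) by (apply pow_R1_Rle; lra).
    replace (M * 2 ^ S n) with (2 * (M * 2 ^ n)) by (simpl; ring).
    eapply Rle_trans; [apply Hstep; nra|auto]. }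
  exists (F M + / (1 - th) * w M). intros t Ht.
  destruct (Pow_x_infinity 2) with (b := t) as [n Hn]; [rewrite Rabs_pos_eq; lra|].
  specialize (Hn n (le_n n)). rewrite Rabs_pos_eq in Hn by (apply pow_le; lra).
  apply Rle_trans with (F (M * 2 ^ n)); [apply Hmono; nra|].
  specialize (Hin n). assert (H2n : 0 < 2 ^ n) by (apply pow_lt; lra).
  assert (0 < / (1 - th) * w (M * 2 ^ n)); [|lra].
  apply Rmult_lt_0_compat; [apply Rinv_0_lt_compat; lra|apply Hwp, Rmult_lt_0_compat; lra].
Qed.

Lemma bounded_tail_integral f g C : (forall t, 0 <= t -> f t = g t) -> cts g -> (forall t, 0 <= g t) ->
  (forall t, 0 <= t -> RInt g 0 t <= C) -> exists l, tail_integral f 0 l.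
Proof.
  intros Hfg Hg Hp HC.
  destruct (completeness (fun v => exists t, 0 <= t /\ v = RInt g 0 t)) as [l [Hub Hlub]].
  - exists C. intros v [t [Ht ->]]. auto.
  - exists (RInt g 0 0), 0. split; [lra|auto].
  - exists l. intros eps He.
    destruct (Classical_Prop.classic (exists t, 0 <= t /\ l - eps < RInt g 0 t)) as [[t0 [Ht0 H0]]|Hn].
    + exists t0. intros T HT. exists (RInt g 0 T). split.
      * apply is_RInt_of_cts; auto; [lra|]. intros; apply Hfg; lra.
      * assert (RInt g 0 T <= l) by (apply Hub; exists T; split; [lra|auto]).
        pose proof (RInt_split g 0 t0 T Hg).
        assert (0 <= RInt g t0 T) by (apply RInt_nonneg; auto; lra).
        apply Rabs_def1; lra.
    + exfalso. assert (l <= l - eps); [|lra]. apply Hlub. intros v [t [Ht ->]].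
      apply Rnot_lt_le. intro H. apply Hn. exists t. auto.
Qed.

Theorem theorem3p1
  (k lam L r : R -> R) (alpha a : R)
  (* (C1) *)
  (Hkpos : forall t, 0 <= t -> k t > 0)
  (Hkcont : cont_nonneg k)
  (Hkint : tail_integral k 0 (- a))
  (* definition of lambda *)
  (Hlam : forall t, 0 <= t -> tail_integral k t (lam t))
  (* (C2) *)
  (Hlogconv : forall x y th, 0 <= x -> 0 <= y -> 0 <= th <= 1 ->
      ln (lam (th * x + (1 - th) * y)) <= th * ln (lam x) + (1 - th) * ln (lam y))
  (* (C3) *)
  (Halpha : 0 < alpha < 1)
  (HLpos : forall t, 0 <= t -> L t > 0)
  (HLsv : slowly_varying L)
  (HlamL : forall t, t > 0 -> lam t = L t * Rpower t (- alpha))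
  (* r solves the equation *)
  (Hrcont : cont_nonneg r)
  (Hr0 : r 0 = 1)
  (Hrde : forall t, t > 0 -> exists v,
      is_RInt (fun s => k (t - s) * r s) 0 t v /\
      derivable_pt_lim r t (a * r t + v)) :
  lim_infty (fun t => r t * Rpower t (1 - alpha) * L t) (sin (alpha * PI) / PI)
  /\ (alpha < 1 / 2 -> in_L2_nonneg r /\ ~ in_L1_nonneg r).
Proof.
  destruct (renewal_equation k lam r a) as [lE [rE [Hlc [Hrc [El [Er [Hlp [Hld [Hrp [Hrd Heq]]]]]]]]]]; auto.
  { intros t Ht. rewrite HlamL by auto. apply Rmult_lt_0_compat; [apply HLpos; lra|apply Rpower_pos]. }
  assert (Hrv : forall x, 0 < x -> is_lim (fun t => lE (x * t) / lE t) p_infty (Rpower x (- alpha))).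
  { intros x Hx. apply (is_lim_ext_loc (fun t => L (x * t) / L t * Rpower x (- alpha))).
    - exists 0. intros t Ht. assert (0 < x * t) by (apply Rmult_lt_0_compat; auto).
      rewrite !El, !HlamL, <- Rpower_mult_distr by lra.
      pose proof (HLpos t). pose proof (Rpower_pos t (- alpha)). field. lra.
    - replace (Finite (Rpower x (- alpha))) with (Finite (1 * Rpower x (- alpha))) by (f_equal; ring).
      apply lim_mult; [|apply is_lim_const]. apply lim_ev. intros eps He.
      destruct (HLsv x Hx eps He) as [M HM]. exists M. intros t Ht. left. apply HM. lra. }
  assert (Hh : reg_var lE (- alpha)) by (apply monotone_rv; auto; lra).
  pose proof PI_gt_3 as HPI.
  assert (Hs : 0 < sin (alpha * PI)) by (apply sin_gt_0; nra).
  destruct (renewal_asymptotics lE rE alpha (PI / sin (alpha * PI))) as [Hlim [HU Hb]]; auto.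
  { apply is_beta_sin; auto. }
  { apply Rdiv_lt_0_compat; lra. }
  split; [|intro Ha; split].
  - intros eps He. destruct (proj1 (lim_ev _ _) Hlim (eps / 2) ltac:(lra)) as [M HM].
    exists (Rmax 0 M + 1). intros t Ht. pose proof (Rmax_l 0 M). pose proof (Rmax_r 0 M).
    specialize (HM t ltac:(lra)). rewrite El, Er, HlamL in HM by lra.
    replace (/ (PI / sin (alpha * PI))) with (sin (alpha * PI) / PI) in HM by (field; lra).
    replace (r t * Rpower t (1 - alpha) * L t) with (t * r t * (L t * Rpower t (- alpha))); [lra|].
    unfold Rminus. rewrite Rpower_plus, Rpower_1 by lra. ring.
  - destruct (square_integral_bounded lE rE alpha) as [C HC]; auto; [lra|].
    apply (bounded_tail_integral (fun s => r s ^ 2) (fun s => rE s ^ 2) C); auto.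
    + intros t Ht. rewrite Er; auto.
    + cts_tac.
    + intros; apply pow2_ge_0.
  - intros [l Hl]. destruct (Hl 1 ltac:(lra)) as [M HM].
    (* Since [r] is positive, its absolute value has the same integrals; at [T] they would be within
       1 of [l] and yet exceed [l + 1]. *)
    apply is_lim_spec in HU. destruct (HU (l + 1)) as [M' HM'].
    set (T := Rmax 0 (Rmax M M') + 1).
    pose proof (Rmax_l 0 (Rmax M M')). pose proof (Rmax_r 0 (Rmax M M')).
    pose proof (Rmax_l M M'). pose proof (Rmax_r M M').
    destruct (HM T) as [v [Hv Hvl]]; [unfold T; lra|].
    apply (is_RInt_value _ rE) in Hv; [|unfold T; lra|].
    2:{ intros x Hx. rewrite <- Er by lra. apply Rabs_pos_eq. left; apply Hrp; lra. }
    specialize (HM' T ltac:(unfold T; lra)). apply Rabs_lt_between in Hvl. lra.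
Qed.
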